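(* Let $p\in(2,\infty)$ and $\delta\in(0,1]$. Assume that no $w\in\mathbb{R}^d$ satisfies $Y=\langle w,X\rangle$ (almost surely). Further assume that $\mathrm{E}[|Y|^p]<\infty$, $\mathrm{E}[|X^j|^p]<\infty$, and $\mathrm{E}\left[|\langle w_p^{*},X\rangle-Y|^{2(p-2)}(X^j)^4\right]<\infty$ for all $j\in[d]$. If $$n\ge 196\,\sigma_p^2\,\bigl(d+2\log(4/\delta)\bigr),$$ then with probability at least $1-\delta$, $$R_p(\hat w_p)-R_p(w_p^{*})\le \frac{2048\,p^2\,\mathrm{E}\left[\|\nabla\ell_p(\langle w_p^{*},X\rangle-Y)\|_{H_p^{-1}}^2\right]}{n\delta}+\left(\frac{512\,p^4c_p^2\,\mathrm{E}\left[\|\nabla\ell_p(\langle w_p^{*},X\rangle-Y)\|_{H_p^{-1}}^2\right]}{n\delta}\right)^{p/2}.$$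
   Context: $X=(X^1,\dots,X^d)$ is a random vector in $\mathbb{R}^d$, $Y$ a real random variable, $(X_i,Y_i)_{i=1}^n$ i.i.d. copies of $(X,Y)$, $[d]=\{1,\dots,d\}$. Standing assumption: the support of $X$ is not contained in any hyperplane, i.e. $\mathrm{P}(\langle w,X\rangle=0)=1$ only if $w=0$. Let $\ell_p(t):=|t|^p/[p(p-1)]$, $R_p(w):=\mathrm{E}[\ell_p(\langle w,X\rangle-Y)]$, $R_{p,n}(w):=\frac1n\sum_{i=1}^n\ell_p(\langle w,X_i\rangle-Y_i)$. Let $w_p^{*}$ be the minimizer of $R_p$ over $\mathbb{R}^d$ and $\hat w_p\in\arg\min_{w\in\mathbb{R}^d}R_{p,n}(w)$ any empirical risk minimizer. Gradients and Hessians of the loss are with respect to $w$: $\nabla\ell_p(\langle w,X\rangle-Y)=\ell_p'(\langle w,X\rangle-Y)X$ and $\nabla^2\ell_p(\langle w,X\rangle-Y)=|\langle w,X\rangle-Y|^{p-2}XX^T$. $H_p:=\nabla^2R_p(w_p^{*})$, which is understood to be invertible (as presupposed by the notation $H_p^{-1}$). For a positive semi-definite matrix $A$, $\|v\|_A:=\sqrt{v^TAv}$. Define $\|w\|_{L^p}:=\mathrm{E}[|\langle w,X\rangle|^p]^{1/p}$ and, for $q\in[1,\infty)$, $\|w\|_{L^q,p}:=\mathrm{E}\left[\|w\|_{\nabla^2\ell_p(\langle w_p^{*},X\rangle-Y)}^q\right]^{1/q}$ (so $\|w\|_{L^2,p}=\|w\|_{H_p}$). Then $$\sigma_p^2:=\left(\sup_{w\in\mathbb{R}^d\setminus\{0\}}\frac{\|w\|_{L^4,p}}{\|w\|_{L^2,p}}\right)^4,\qquad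 c_p:=\sup_{w\in\mathbb{R}^d\setminus\{0\}}\frac{\|w\|_{L^p}}{\|w\|_{L^2,p}}.$$ *)

(* Defs.v *)
From HB Require Import structures.
From mathcomp Require Import all_boot all_order all_algebra.
From mathcomp Require Import all_classical all_reals all_analysis.
Set Implicit Arguments.
Unset Strict Implicit.
Unset Printing Implicit Defensive.
Import Order.TTheory GRing.Theory Num.Theory.
Import numFieldNormedType.Exports.
Local Open Scope classical_set_scope.
Local Open Scope ring_scope.

(* Parameters w are column vectors.  Values of random vectors are tuples,
   because the library puts the product sigma-algebra of R^d on d.-tuple R. *)
Definition inner (R : realType) (d : nat) (w : 'cV[R]_d) (x : d.-tuple R) : R :=
  \sum_(j < d) w j ord0 * tnth x j.

Definition gradient (R : realType) (d : nat) (f : 'cV[R]_d -> R)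
    (w : 'cV[R]_d) : 'cV[R]_d :=
  \col_(i < d) 'D_(delta_mx i ord0) f w.

Definition hessian (R : realType) (d : nat) (f : 'cV[R]_d -> R)
    (w : 'cV[R]_d) : 'M[R]_d :=
  \matrix_(i < d, j < d)
    'D_(delta_mx i ord0) (fun v => 'D_(delta_mx j ord0) f v) w.

Definition mxnorm (R : realType) (d : nat) (A : 'M[R]_d) (v : 'cV[R]_d) : R :=
  Num.sqrt ((v^T *m A *m v) ord0 ord0).

Definition ell (R : realType) (p t : R) : R := `|t| `^ p / (p * (p - 1)).

(* As a function of w, so that [gradient] and [hessian] apply to it. *)
Definition loss (R : realType) (d : nat) (p : R) (x : d.-tuple R) (y : R)
    (w : 'cV[R]_d) : R :=
  ell p (inner w x - y).

Definition emp_risk (R : realType) (d n : nat) (p : R) (x : 'I_n -> d.-tuple R)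
    (y : 'I_n -> R) (w : 'cV[R]_d) : R :=
  n%:R^-1 * \sum_(i < n) loss p (x i) (y i) w.

Definition identically_distributed (R : realType) (disp disp' : measure_display)
    (T : measurableType disp) (T' : measurableType disp')
    (P : probability T R) (Z Z' : T -> T') : Prop :=
  forall B : set T', measurable B -> P (Z @^-1` B) = P (Z' @^-1` B).

Definition mutually_independent (R : realType) (disp disp' : measure_display)
    (T : measurableType disp) (T' : measurableType disp')
    (P : probability T R) (I : finType) (Z : I -> T -> T') : Prop :=
  forall (J : {set I}) (B : I -> set T'), (forall i, measurable (B i)) ->
    P (\bigcap_(i in [set` J]) (Z i @^-1` B i)) =
    (\prod_(i in J) P (Z i @^-1` B i))%E.

(* The event E may fail to be measurable, for instance when it involves an
   arbitrary selection of minimizers; for a measurable E this is q <= P E. *)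
Definition with_probability_ge (R : realType) (disp : measure_display)
    (T : measurableType disp) (P : probability T R) (q : R) (E : set T) : Prop :=
  exists A : set T, [/\ measurable A, A `<=` E & (q%:E <= P A)%E].

Section Population.
Context (R : realType) (disp : measure_display) (T : measurableType disp)
  (P : probability T R) (d : nat) (p : R).
Context (X : T -> d.-tuple R) (Y : T -> R).
Local Open Scope ereal_scope.

Definition risk (w : 'cV[R]_d) : \bar R :=
  'E_P[fun t => loss p (X t) (Y t) w].

Definition normLp (w : 'cV[R]_d) : \bar R :=
  'N[P]_(p%:E)[(fun t => (inner w (X t))%:E)].

(* In the remaining definitions, ws stands for the minimizer of [risk]. *)
Definition normLqp (ws : 'cV[R]_d) (q : R) (w : 'cV[R]_d) : \bar R :=
  'N[P]_(q%:E)[(fun t =>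
    (mxnorm (hessian (loss p (X t) (Y t)) ws) w)%:E)].

Definition Hp (ws : 'cV[R]_d) : 'M[R]_d := hessian (fun w => fine (risk w)) ws.

Definition sigma2 (ws : 'cV[R]_d) : \bar R :=
  (ereal_sup [set normLqp ws 4 w / normLqp ws 2 w | w in [set w | w != 0%R]])
    ^+ 4.

Definition cp (ws : 'cV[R]_d) : \bar R :=
  ereal_sup [set normLp w / normLqp ws 2 w | w in [set w | w != 0%R]].

(* Possibly +oo: finiteness does not follow from the moment conditions
   under which the bounds are stated. *)
Definition grad_noise (ws : 'cV[R]_d) : \bar R :=
  'E_P[fun t =>
    (mxnorm (invmx (Hp ws)) (gradient (loss p (X t) (Y t)) ws) ^+ 2)%R].

End Population.

(* Main.v *)
Require Import Defs.
From HB Require Import structures.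
From mathcomp Require Import all_boot all_order all_algebra.
From mathcomp Require Import all_classical all_reals all_analysis.
From mathcomp Require Import measurable_realfun measurable_fun_approximation ring lra.

(** The proof compares, for the two arguments [s] and [s + h] of the loss, the
    second order remainder [ell p (s + h) - ell p s - ell_slope p s * h] with
    the curvature term [|s|^(p-2) h^2]:
    - it is at least [|s|^(p-2) h^2 / (2 (p-1))]  ([ell_bregman_ge]);
    - it is at most [4 |s|^(p-2) h^2 + p^p |h|^p]  ([ell_bregman_le]).
    Both come from the convexity of [x^q] alone.

    Write [H] for the Hessian of the risk at its minimizer [ws], [w] for the
    empirical minimizer and [Q = (w - ws)^T H (w - ws)].  Averaged over the
    population, where the linear term vanishes by optimality of [ws], the upper
    bound says that the excess risk is at most
    [4 Q + p^p E|<w - ws, X>|^p <= 4 Q + (p c_p sqrt Q)^p], so that everything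
    reduces to [Q <= 512 p^2 G / (n delta)], where [G] is the noise
    [E |grad|^2] in the norm of [H^-1].

    Averaged over the sample, the lower bound together with the optimality of
    [w] says that the empirical curvature at [w - ws] is controlled by the
    empirical gradient at [ws] ([empirical_minimizer_le]).  Two events of
    probability at least [1 - delta / 2] then give the bound on [Q].
    - The squared norm of the empirical gradient is at most [2 G / (n delta)],
      by Markov's inequality and the variance formula for independent centred
      variables ([score_noise], [mean_sqr_sum]).
    - The empirical curvature dominates [H / 8] in all directions at once
      ([lower_tail]).

    The second event is the heart of the matter.  After a change of basis the
    curvature is [<u, z>^2] for a random vector [z] with identity second moment
    and [E <u, z>^4 <= kappa |u|^4], where [kappa] is [sigma_p^2].  For a single
    [u], Chernoff's method applied to nonpositive exponents needs no more than
    four moments.  To pass to all [u], each [u] is rounded to a lattice of step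
    [eta = |u| / (2 sqrt d)], coordinate by coordinate, in such a way that a
    quadratic form increases by at most [eta^2 / 4] times its trace
    ([shifted_form_round]).  The number of lattice vectors reached is exponential
    in [d] ([card_l1_ball]), which a union bound affords.  The trace is kept small
    by discarding the observations with [|z|^2 > 4 kappa d]; this costs at most a
    quarter of the second moment ([mean_truncated_ge]). *)

Set Implicit Arguments.
Unset Strict Implicit.
Unset Printing Implicit Defensive.
Import Order.TTheory GRing.Theory Num.Theory.
Import numFieldNormedType.Exports.
Local Open Scope classical_set_scope.
Local Open Scope ring_scope.

(** * Remainder inequalities for the loss *)

Section Power.
Context (R : realType).
Implicit Types p q s t h x y : R.

(** Young's inequality for [x] and [y^(q-1)], with exponents [q] and [q/(q-1)]. *)
Lemma powR_tangent q x y : 1 <= q -> 0 <= x -> 0 <= y ->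
  y `^ q + q * y `^ (q - 1) * (x - y) <= x `^ q.
Proof.
rewrite le_eqVlt => /predU1P[<-|q1] x0 y0.
  by rewrite subrr powRr0 !powRr1 // mulr1 mul1r addrC subrK.
have q0 : 0 < q by lra.
have qm : q - 1 != 0 by rewrite subr_eq0 gt_eqF.
have := @conjugate_powR _ x (y `^ (q - 1)) q (q / (q - 1)) x0 (powR_ge0 _ _).
have -> : (y `^ (q - 1)) `^ (q / (q - 1)) = y `^ q.
  by rewrite -powRrM; congr powR; field.
have yq : y * y `^ (q - 1) = y `^ q by apply: mulr_powRB1.
have -> : q^-1 + (q / (q - 1))^-1 = 1.
  by field; rewrite qm gt_eqF.
move=> /(_ q0 (divr_gt0 q0 _) erefl); rewrite subr_gt0 => /(_ q1).
set A := y `^ (q - 1); set B := y `^ q; set C := x `^ q => H.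
have H' := ler_wpM2l (ltW q0) H.
have E : q * (C / q + B / (q / (q - 1))) = C + (q - 1) * B.
  by field; rewrite qm gt_eqF.
rewrite E in H'.
rewrite mulrBr -[q * A * y]mulrA [A * y]mulrC yq -/B; lra.
Qed.

Lemma sqr_normE x : `|x| ^+ 2 = x ^+ 2.
Proof. by rewrite real_normK ?num_real. Qed.

Lemma norm_powR_sqr q x : (x ^+ 2) `^ q = `|x| `^ (2 * q).
Proof. by rewrite -sqr_normE -powR_mulrn // -powRrM. Qed.

(** The derivative [sgn t * |t|^(p-1) / (p-1)] of [ell p], written without a sign
    so that it factors through the curvature [|t|^(p-2)]. *)
Definition ell_slope p t : R := t * `|t| `^ (p - 2) / (p - 1).

Lemma norm_powRE p t : 2 < p -> `|t| `^ p = t ^+ 2 * `|t| `^ (p - 2).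
Proof.
move=> p2; have [->|t0] := eqVneq t 0.
  by rewrite normr0 powR0 ?expr0n ?mul0r // gt_eqF //; lra.
have -> : `|t| `^ p = `|t| `^ (p - 2) * `|t| `^ 2.
  by rewrite -powRD ?subrK // normr_eq0 t0 implybT.
by rewrite powR_mulrn // sqr_normE mulrC.
Qed.

(** Since [|t|^p = (t^2)^(p/2)], the tangent inequality may be used at the point
    [s^2].  In [(s+h)^2 - s^2 = 2 s h + h^2] the first summand produces the slope
    and the second one the gain.  The constant is optimal: there is equality at
    [h = -2 s]. *)
Lemma ell_bregman_ge p s h : 2 < p ->
  `|s| `^ (p - 2) * h ^+ 2 / (2 * (p - 1)) <=
  ell p (s + h) - ell p s - ell_slope p s * h.
Proof.
move=> p2.
have := @powR_tangent (p / 2) ((s + h) ^+ 2) (s ^+ 2) _ (sqr_ge0 _) (sqr_ge0 _).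
rewrite !norm_powR_sqr.
have -> : 2 * (p / 2) = p by field.
have -> : 2 * (p / 2 - 1) = p - 2 by field.
rewrite /ell /ell_slope (norm_powRE s p2).
set A := `|s| `^ (p - 2); set C := `|s + h| `^ p.
have p1 : 1 <= p / 2 by rewrite ler_pdivlMr ?mul1r; lra.
move=> /(_ p1) H; rewrite -subr_ge0.
have p0 : p != 0 by rewrite gt_eqF; lra.
have q0 : p - 1 != 0 by rewrite gt_eqF; lra.
have -> : C / (p * (p - 1)) - s ^+ 2 * A / (p * (p - 1)) - s * A / (p - 1) * h
    - A * h ^+ 2 / (2 * (p - 1)) =
  (C - (s ^+ 2 * A + p / 2 * A * ((s + h) ^+ 2 - s ^+ 2))) / (p * (p - 1)).
  by field; rewrite p0 q0.
by apply: divr_ge0; [rewrite subr_ge0 | apply: mulr_ge0; lra].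
Qed.

(** The left-hand side is below [e] because [1 + x <= exp x]. *)
Lemma powR_1DV_le q : 0 < q -> (1 + (q + 1)^-1) `^ q <= 4.
Proof.
move=> q0; apply: (@le_trans _ _ (expR 1)); last first.
  have h : expR (1 / 2) <= 2 :> R.
    have := @expR_ge1Dx R (- (1 / 2)); rewrite expRN => H.
    have e0 := expR_gt0 (1 / 2 : R).
    rewrite -(ler_pM2l e0) mulrV ?unitfE ?gt_eqF // in H; lra.
  have -> : 1 = 1 / 2 + 1 / 2 :> R by field.
  rewrite expRD; have e0 := expR_gt0 (1 / 2 : R); nra.
have i0 : 0 < (q + 1)^-1 by rewrite invr_gt0; lra.
apply: (@le_trans _ _ (expR (q + 1)^-1 `^ q)).
  by apply: ge0_ler_powR; rewrite ?nnegrE ?expR_ge0 ?expR_ge1Dx //; lra.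
rewrite -expRM ler_expR mulrC ler_pdivrMr; lra.
Qed.

(** If [|s| <= (p-1) |h|], then [|s + h| <= p |h|], so that [p^p |h|^p] pays for
    the loss at [s + h], and the slope term is at most [|s|^(p-2) h^2].  Otherwise
    [s + h] has the sign of [s], and the tangent inequality, used for the exponent
    [p] and then for [p - 1], bounds the remainder by the curvature at [s] or at
    [s + h], whichever is larger; they differ by a factor at most [4]. *)
Lemma ell_bregman_le p s h : 2 < p ->
  ell p (s + h) - ell p s - ell_slope p s * h <=
  4 * (`|s| `^ (p - 2) * h ^+ 2) + p `^ p * `|h| `^ p.
Proof.
move=> p2.
have p0 : p != 0 by rewrite gt_eqF; lra.
have q0 : p - 1 != 0 by rewrite gt_eqF; lra.
have pq0 : 0 < p * (p - 1) by apply: mulr_gt0; lra.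
wlog s0 : s h / 0 <= s => [hwlog|].
  case: (leP 0 s) => s0; first exact: hwlog.
  have := hwlog (- s) (- h).
  rewrite /ell /ell_slope -opprD !normrN sqrrN !mulNr mulrN opprK; apply.
  by rewrite oppr_ge0 ltW.
have [sh|sh] := lerP s ((p - 1) * `|h|).
  have le1 : `|s + h| `^ p <= p `^ p * `|h| `^ p.
    rewrite -powRM //; last lra.
    apply: ge0_ler_powR; rewrite ?nnegrE //; first lra.
    apply: mulr_ge0 => //; lra.
    by apply: le_trans (ler_normD _ _) _; rewrite (ger0_norm s0); lra.
  rewrite /ell /ell_slope (norm_powRE s p2).
  set A := `|s| `^ (p - 2); have A0 : 0 <= A := powR_ge0 _ _.
  have B0 : 0 <= p `^ p * `|h| `^ p by rewrite mulr_ge0 ?powR_ge0.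
  set C := `|s + h| `^ p in le1 *; set B := p `^ p * _ in le1 B0 *.
  have -> : C / (p * (p - 1)) - s ^+ 2 * A / (p * (p - 1)) - s * A / (p - 1) * h
     = (C - s ^+ 2 * A + p * (s * A * - h)) / (p * (p - 1)).
    by field; rewrite p0 q0.
  rewrite ler_pdivrMr //.
  have h1 : s * A * - h <= (p - 1) * (A * h ^+ 2).
    apply: (@le_trans _ _ (s * A * `|h|)).
      by rewrite ler_wpM2l ?mulr_ge0 // -normrN ler_norm.
    rewrite -sqr_normE; have := normr_ge0 h; set k := `|h| in sh * => k0.
    have : s * (A * k) <= (p - 1) * k * (A * k) by rewrite ler_wpM2r ?mulr_ge0.
    rewrite expr2; lra.
  have h2 : 0 <= s ^+ 2 * A by rewrite mulr_ge0 ?sqr_ge0.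
  have Ah0 : 0 <= A * h ^+ 2 by rewrite mulr_ge0 ?sqr_ge0.
  have h3 : p * (s * A * - h) <= p * ((p - 1) * (A * h ^+ 2)).
    by rewrite ler_wpM2l //; lra.
  have h4 : B <= B * (p * (p - 1)) by rewrite ler_peMr //; nra.
  have h5 : 0 <= p * (p - 1) * (A * h ^+ 2) by rewrite mulr_ge0 // ltW.
  lra.
have hp : `|h| <= s / (p - 1).
  by rewrite ler_pdivlMr 1?mulrC; [exact: ltW | lra].
have hs : `|h| <= s.
  apply: (le_trans hp); rewrite ler_pdivrMr; last lra.
  by rewrite ler_peMr //; lra.
have h_ge : - s <= h by move: hs; rewrite ler_norml => /andP[].
have y0 : 0 <= s + h by lra.
have E : forall u : R, 0 <= u -> ell p u = u `^ p / (p * (p - 1)).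
  by move=> u u0; rewrite /ell ger0_norm.
have Es : ell_slope p s = s `^ (p - 1) / (p - 1).
  rewrite /ell_slope (ger0_norm s0); congr (_ / _).
  have -> : p - 2 = p - 1 - 1 by lra.
  by rewrite mulr_powRB1 //; lra.
rewrite Es !E // (ger0_norm s0).
have t1 := @powR_tangent p s (s + h) (ltW (lt_trans _ p2)) s0 y0.
have {}t1 := t1 ltac:(lra).
have B0 : 0 <= p `^ p * `|h| `^ p by rewrite mulr_ge0 ?powR_ge0.
have A0 : 0 <= s `^ (p - 2) by exact: powR_ge0.
have key : h * ((s + h) `^ (p - 1) - s `^ (p - 1)) <=
    4 * (p - 1) * (s `^ (p - 2) * h ^+ 2).
  have e2 : p - 1 - 1 = p - 2 by lra.
  have [h0|h0] := lerP 0 h.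
    have := @powR_tangent (p - 1) s (s + h) ltac:(lra) s0 y0.
    rewrite e2 => H.
    have : (s + h) `^ (p - 2) <= 4 * s `^ (p - 2).
      apply: (@le_trans _ _ ((s * (1 + (p - 2 + 1)^-1)) `^ (p - 2))).
        apply: ge0_ler_powR; rewrite ?nnegrE //; first lra.
          apply: mulr_ge0 => //; apply: addr_ge0 => //.
          by rewrite invr_ge0; lra.
        rewrite mulrDr mulr1 lerD2l; have -> : p - 2 + 1 = p - 1 by lra.
        by rewrite -(ger0_norm h0).
      rewrite powRM //; last first.
        by apply: addr_ge0 => //; rewrite invr_ge0; lra.
      by rewrite mulrC ler_wpM2r // powR_1DV_le //; lra.
    set a := (s + h) `^ (p - 1) in H *; set b := s `^ (p - 1) in H *.
    set c := (s + h) `^ (p - 2) in H *; set A := s `^ (p - 2) in A0 * => H2.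
    have H3 : a - b <= (p - 1) * c * h by lra.
    have H4 : h * (a - b) <= h * ((p - 1) * c * h) by rewrite ler_wpM2l.
    have H5 : (p - 1) * h ^+ 2 * c <= (p - 1) * h ^+ 2 * (4 * A).
      by rewrite ler_wpM2l // mulr_ge0 ?sqr_ge0 //; lra.
    rewrite expr2 in H5 *; lra.
  have := @powR_tangent (p - 1) (s + h) s ltac:(lra) y0 s0.
  rewrite e2 => H.
  set a := (s + h) `^ (p - 1) in H *; set b := s `^ (p - 1) in H *.
  set A := s `^ (p - 2) in A0 H *.
  have H3 : (p - 1) * A * h <= a - b by lra.
  have H4 : h * (a - b) <= h * ((p - 1) * A * h) by rewrite ler_wnM2l // ltW.
  have H5 : 0 <= (p - 1) * h ^+ 2 * A.
    by rewrite mulr_ge0 // mulr_ge0 ?sqr_ge0 //; lra.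
  rewrite expr2 in H5 *; lra.
set a := (s + h) `^ (p - 1) in key t1 *; set b := s `^ (p - 1) in key *.
set A := s `^ (p - 2) in A0 key *; set B := p `^ p * _ in B0 *.
have -> : (s + h) `^ p / (p * (p - 1)) - s `^ p / (p * (p - 1)) - b / (p - 1) * h
  = ((s + h) `^ p - s `^ p - p * b * h) / (p * (p - 1)).
  by field; rewrite p0 q0.
rewrite ler_pdivrMr //.
have k2 : p * (h * (a - b)) <= p * (4 * (p - 1) * (A * h ^+ 2)).
  by rewrite ler_wpM2l //; lra.
have k3 : 0 <= p * (p - 1) * B by rewrite mulr_ge0 // ltW.
lra.
Qed.

End Power.

(** * Derivatives of the loss *)

Section Derivatives.
Context (R : realType).
Implicit Types p q s t h x y : R.

Lemma is_derive_cvg (V : normedModType R) (f : V -> R) (w v : V) (L : R) :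
  h^-1 *: (f (h *: v + w) - f w) @[h --> 0^'] --> L -> is_derive w v f L.
Proof.
move=> cvgL; apply: DeriveDef; first by apply/cvg_ex; exists L.
exact: cvg_lim.
Qed.

Lemma is_derive_line (V : normedModType R) (f : V -> R) (w v : V) (L : R) :
  is_derive (0 : R) 1 (fun h : R => f (h *: v + w)) L -> is_derive w v f L.
Proof.
case=> d1 d2; apply: is_derive_cvg; rewrite -d2 /derive.
move: d1; rewrite /derivable /=.
under eq_fun do rewrite addr0 scale0r add0r [_ *: 1]mulr1.
by [].
Qed.

(** A quadratic bound on the remainder determines the directional derivative.
    It serves the loss and, after integration of the bound, the risk, whose first
    derivative thus requires no exchange of limit and expectation. *)
Lemma is_derive_quadratic (V : normedModType R) (f : V -> R) (w v : V) (L C : R) :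
  (forall h : R, `|h| <= 1 -> `|f (h *: v + w) - f w - h * L| <= C * h ^+ 2) ->
  is_derive w v f L.
Proof.
move=> fC; apply: is_derive_cvg; apply/cvgrPdist_le => e e0.
have C0 : 0 <= C.
  have := fC 1; rewrite normr1 expr1n mulr1 => /(_ (lexx _)).
  exact: le_trans (normr_ge0 _).
near=> h.
have h0 : h != 0 by near: h; exact: nbhs_dnbhs_neq.
have hn0 : 0 < `|h| by rewrite normr_gt0.
have h1 : `|h| <= 1 by near: h; apply: dnbhs0_le.
have h2 : `|h| <= e / (C + 1).
  by near: h; apply: dnbhs0_le; rewrite divr_gt0 //; lra.
have -> : L - h^-1 *: (f (h *: v + w) - f w) =
          - (h^-1 * (f (h *: v + w) - f w - h * L)).
  by rewrite mulrBr mulrA mulVf // mul1r opprB.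
rewrite normrN normrM normfV ler_pdivrMl //.
apply: (le_trans (fC _ h1)); rewrite -sqr_normE.
have : `|h| * (C + 1) <= e by rewrite -ler_pdivlMr //; lra.
nra.
Unshelve. all: by end_near. Qed.

Lemma is_derive_ell_slope p t : 2 < p ->
  is_derive t 1 (ell_slope p) (`|t| `^ (p - 2)).
Proof.
move=> p2; have p1 : p - 1 != 0 by rewrite gt_eqF; lra.
have pos (u : R) : 0 < u -> ell_slope p u = (p - 1)^-1 * u `^ (p - 1).
  move=> u0; rewrite /ell_slope (gtr0_norm u0) [RHS]mulrC; congr (_ / _).
  have -> : p - 2 = p - 1 - 1 by lra.
  by rewrite mulr_powRB1 ?ltW //; lra.
have e2 : p - 1 - 1 = p - 2 by lra.
have dpos (u : R) : 0 < u -> is_derive u 1 (ell_slope p) (u `^ (p - 2)).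
  move=> u0; apply: (@near_eq_is_derive _ _ _ (fun u : R => (p - 1)^-1 * u `^ (p - 1))).
  - near=> v; rewrite pos //; near: v; exact: lt_nbhsr.
  - have H := @is_derive1_powR R (p - 1) u u0.
    have := is_deriveZ (p - 1)^-1 H.
    by rewrite e2 /GRing.scale /= mulKf.
have odd (u : R) : ell_slope p (- u) = - ell_slope p u.
  by rewrite /ell_slope normrN !mulNr.
case: (ltgtP t 0) => [t0|t0|->]; last 1 first.
  (* at the origin the quotient is |h|^(p-2), which tends to 0 *)
- apply: is_derive_cvg; rewrite normr0 powR0; last by rewrite gt_eqF; lra.
  apply/cvgrPdist_le => e e0; near=> h.
  have h0 : h != 0 by near: h; exact: nbhs_dnbhs_neq.
  rewrite addr0 [h *: 1]mulr1 /ell_slope mul0r mul0r subr0 sub0r normrN.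
  rewrite -mulrA [_ *: _]mulrA mulVf // mul1r normrM ger0_norm ?powR_ge0 //.
  rewrite gtr0_norm; last by rewrite invr_gt0; lra.
  rewrite ler_pdivrMr; last lra.
  apply: (@le_trans _ _ e); last by rewrite ler_peMr ?ltW //; lra.
  have -> : e = (e `^ (p - 2)^-1) `^ (p - 2).
    by rewrite -powRrM mulVf ?powRr1 ?ltW // gt_eqF; lra.
  apply: ge0_ler_powR; rewrite ?nnegrE ?powR_ge0 //; first lra.
  by near: h; apply: dnbhs0_le; rewrite powR_gt0.
- have -> : ell_slope p = (fun u : R => - ell_slope p (- u)).
    by apply/funext => u; rewrite odd opprK.
  have Nt : 0 < - t by lra.
  have H := is_derive1_comp (dpos _ Nt) (is_deriveNid t (1 : R)).
  have := is_deriveN H; rewrite ltr0_norm //.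
  by rewrite mulrN1 opprK.
- by rewrite gtr0_norm //; apply: dpos.
Unshelve. all: by end_near. Qed.

Lemma is_derive_ell p t : 2 < p -> is_derive t 1 (ell p) (ell_slope p t).
Proof.
move=> p2; set C := 4 * `|t| `^ (p - 2) + p `^ p.
apply: (@is_derive_quadratic _ _ _ _ _ C) => h h1.
rewrite [h *: 1]mulr1 [h + t]addrC.
have lo := ell_bregman_ge t h p2; have hi := ell_bregman_le t h p2.
rewrite [h * _]mulrC ger0_norm; last first.
  apply: le_trans lo; apply: divr_ge0; last lra.
  by rewrite mulr_ge0 ?powR_ge0 ?sqr_ge0.
apply: (le_trans hi).
have -> : C * h ^+ 2 = 4 * (`|t| `^ (p - 2) * h ^+ 2) + p `^ p * h ^+ 2.
  by rewrite /C; ring.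
rewrite lerD2l ler_wpM2l ?powR_ge0 // norm_powRE // ler_piMr ?sqr_ge0 //.
apply: (@le_trans _ _ (1 `^ (p - 2))); last by rewrite powR1.
by apply: ge0_ler_powR; rewrite ?nnegrE //; lra.
Qed.

Lemma is_derive_affine_comp (g : R -> R) (g' c b a : R) :
  is_derive (c * a + b) 1 g g' -> is_derive a 1 (fun a => g (c * a + b)) (c * g').
Proof.
move=> dg; have D : is_derive a 1 (fun a => c * a + b) c.
  have D1 : is_derive a 1 (fun a : R => c * a) c.
    by have := is_deriveZ c (is_derive_id a (1 : R)); rewrite [_ *: 1]mulr1.
  by have := is_deriveD D1 (is_derive_cst b a (1 : R)); rewrite addr0.
have := @is_derive1_comp R g (fun a => c * a + b) a g' c dg D.
by rewrite mulrC.
Qed.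

End Derivatives.

Section LossDerivatives.
Context (R : realType) (d : nat) (p : R).
Hypothesis p2 : 2 < p.
Implicit Types (w v : 'cV[R]_d) (x : d.-tuple R) (y : R).

Lemma innerD w v x : inner (w + v) x = inner w x + inner v x.
Proof. by rewrite /inner -big_split; apply: eq_bigr => j _; rewrite mxE mulrDl. Qed.

Lemma innerZ (a : R) w x : inner (a *: w) x = a * inner w x.
Proof. by rewrite /inner mulr_sumr; apply: eq_bigr => j _; rewrite mxE mulrA. Qed.

Lemma inner_delta i x : inner (delta_mx i ord0) x = tnth x i.
Proof.
rewrite /inner (bigD1 i) //= mxE !eqxx mul1r big1 ?addr0 // => j ji.
by rewrite mxE (negPf ji) mul0r.
Qed.

Lemma is_derive_inner (g : R -> R) (g' y : R) w v x :
  is_derive (inner w x - y) 1 g g' ->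
  is_derive w v (fun w => g (inner w x - y)) (inner v x * g').
Proof.
move=> dg; apply: is_derive_line.
have E h : inner (h *: v + w) x - y = inner v x * h + (inner w x - y).
  by rewrite innerD innerZ addrA [h * _]mulrC.
under eq_fun do rewrite E.
by apply: is_derive_affine_comp; rewrite mulr0 add0r.
Qed.

Lemma gradient_lossE x y w :
  gradient (loss p x y) w =
  \col_j (ell_slope p (inner w x - y) * tnth x j).
Proof.
apply/colP => j; rewrite !mxE.
have [_ ->] := is_derive_inner (delta_mx j ord0)
   (is_derive_ell (inner w x - y) p2).
by rewrite inner_delta mulrC.
Qed.

Lemma hessian_lossE x y w :
  hessian (loss p x y) w =
  \matrix_(i, j) (`|inner w x - y| `^ (p - 2) * (tnth x i * tnth x j)).
Proof.
apply/matrixP => i j; rewrite !mxE.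
have -> : (fun v => 'D_(delta_mx j ord0) (loss p x y) v) =
   (fun v => tnth x j * ell_slope p (inner v x - y)).
  apply/funext => v; have [_ ->] := is_derive_inner (delta_mx j ord0)
     (is_derive_ell (inner v x - y) p2).
  by rewrite inner_delta.
have D := is_derive_inner (delta_mx i ord0)
   (is_derive_ell_slope (inner w x - y) p2).
have [_] := is_deriveZ (tnth x j) D.
rewrite inner_delta => ->; rewrite /GRing.scale /=; ring.
Qed.

Lemma inner_mulmx w x : inner w x = (w^T *m (\col_j tnth x j)) ord0 ord0.
Proof. by rewrite mxE; apply: eq_bigr => j _; rewrite !mxE. Qed.

Lemma mxnorm_hessian_loss x y w v :
  mxnorm (hessian (loss p x y) w) v =
  Num.sqrt (`|inner w x - y| `^ (p - 2)) * `|inner v x|.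
Proof.
rewrite /mxnorm -(sqrtr_sqr (inner v x)) -sqrtrM ?powR_ge0 //; congr Num.sqrt.
rewrite hessian_lossE; set a := _ `^ _.
have -> : (\matrix_(i, j) (a * (tnth x i * tnth x j))) =
  a *: ((\col_j tnth x j) *m (\col_j tnth x j)^T) :> 'M[R]_d.
  by apply/matrixP => i j; rewrite !mxE big_ord1 !mxE.
rewrite -scalemxAr -scalemxAl mxE; congr (_ * _).
set c := \col_j tnth x j.
have -> : v^T *m (c *m c^T) *m v = (v^T *m c) *m (c^T *m v) by rewrite !mulmxA.
rewrite mxE big_ord1 -inner_mulmx expr2; congr (_ * _).
by rewrite inner_mulmx -[RHS]trace_mx11 -mxtrace_tr trmx_mul trmxK trace_mx11.
Qed.

End LossDerivatives.

(** * Expectations of nonnegative functions *)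

Section Mean.
Context (R : realType) (disp : measure_display) (T : measurableType disp)
  (P : probability T R).
Implicit Types (F G : T -> R) (a b m : R).

(** The expectation of [F], with its integral exposed to the lemmas on
    nonnegative integrands. *)
Definition mean F : \bar R := (\int[P]_t (F t)%:E)%E.

Lemma mean_ge0 F : (forall t, 0 <= F t) -> (0 <= mean F)%E.
Proof. by move=> F0; apply: integral_ge0 => t _; rewrite lee_fin. Qed.

Lemma meanD F G : measurable_fun setT F -> measurable_fun setT G ->
  (forall t, 0 <= F t) -> (forall t, 0 <= G t) ->
  mean (fun t => F t + G t) = (mean F + mean G)%E.
Proof.
move=> mF mG F0 G0; rewrite /mean -ge0_integralD //.
- by move=> t _; rewrite lee_fin.
- exact/measurable_EFinP.
- by move=> t _; rewrite lee_fin.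
- exact/measurable_EFinP.
Qed.

Lemma meanZ F a : measurable_fun setT F -> (forall t, 0 <= F t) -> 0 <= a ->
  mean (fun t => a * F t) = (a%:E * mean F)%E.
Proof.
move=> mF F0 a0; rewrite /mean -ge0_integralZl //.
- exact/measurable_EFinP.
- by move=> t _; rewrite lee_fin.
Qed.

Lemma mean_cst a : mean (fun=> a) = a%:E.
Proof.
by rewrite /mean integral_cst // -[RHS]mule1; congr (_ * _)%E; exact: probability_setT.
Qed.

Lemma mean_le F G : measurable_fun setT F -> measurable_fun setT G ->
  (forall t, 0 <= F t) -> (forall t, F t <= G t) -> (mean F <= mean G)%E.
Proof.
move=> mF mG F0 FG; apply: ge0_le_integral => //.
- by move=> t _; rewrite lee_fin.
- exact/measurable_EFinP.
- exact/measurable_EFinP.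
- by move=> t _; rewrite lee_fin.
Qed.

Lemma mean_sum (I : finType) (F : I -> T -> R) :
  (forall i, measurable_fun setT (F i)) -> (forall i t, 0 <= F i t) ->
  mean (fun t => \sum_i F i t) = (\sum_i mean (F i))%E.
Proof.
move=> mF F0; rewrite /mean -ge0_integral_sum //.
- by apply: eq_integral => t _; rewrite sumEFin.
- by move=> i; exact/measurable_EFinP.
- by move=> i t _; rewrite lee_fin.
Qed.

Lemma eq_mean F G : F =1 G -> mean F = mean G.
Proof. by move=> FG; congr mean; apply/funext. Qed.

Lemma mean_fin F b : measurable_fun setT F -> (forall t, 0 <= F t) ->
  (mean F <= b%:E)%E -> exists2 m, mean F = m%:E & 0 <= m <= b.
Proof.
move=> mF F0 Fb; have m0 := mean_ge0 F0.
have Ffin : mean F \is a fin_num.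
  by rewrite ge0_fin_numE //; exact: (le_lt_trans Fb (ltry _)).
exists (fine (mean F)); first by rewrite fineK.
by rewrite -!lee_fin fineK // m0 Fb.
Qed.

Lemma measurable_ler_set F a : measurable_fun setT F ->
  measurable [set t | a <= F t].
Proof.
move=> mF; have -> : [set t | a <= F t] = setT `&` F @^-1` `[a, +oo[.
  by rewrite setTI; apply/seteqP; split => t; rewrite /= in_itv /= andbT.
exact: mF.
Qed.

Lemma measurable_ltr_set F a : measurable_fun setT F ->
  measurable [set t | F t < a].
Proof.
move=> mF; have -> : [set t | F t < a] = setT `&` F @^-1` `]-oo, a[.
  by rewrite setTI; apply/seteqP; split => t; rewrite /= in_itv /=.
exact: mF.
Qed.

Lemma markov_ge0 F a b : measurable_fun setT F -> (forall t, 0 <= F t) ->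
  0 < a -> (mean F <= b%:E)%E -> (P [set t | (a <= F t)%R] <= (b / a)%:E)%E.
Proof.
move=> mF F0 a0 Fb; set A := [set t | _].
have mA : measurable A by exact: measurable_ler_set.
rewrite mulrC EFinM -lee_pdivrMl ?invr_gt0 // invrK.
apply: le_trans Fb.
have -> : P A = mean (\1_A : T -> R).
  by rewrite -[X in P X]setIT -integral_indic.
rewrite -(meanZ _ _ (ltW a0)) //.
apply: mean_le => //.
- by apply: measurable_funM.
- by move=> t; rewrite mulr_ge0 // ltW.
move=> t; rewrite indicE; have [At|At] := pselect (A t).
  by rewrite mem_set // mulr1.
by rewrite memNset // mulr0.
Qed.

End Mean.

Section ExpBounds.
Context (R : realType).
Implicit Types x : R.

(** The coefficient [3/4] is what [exp x >= (1 + x/2)^2] yields. *)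
Lemma expRN_le_quadratic x : 0 <= x -> expR (- x) <= 1 - x + 3 / 4 * x ^+ 2.
Proof.
move=> x0; rewrite expRN.
have e1 : 1 + x / 2 <= expR (x / 2) by exact: expR_ge1Dx.
have e2 : (1 + x / 2) ^+ 2 <= expR x.
  have -> : x = x / 2 + x / 2 by field.
  rewrite expRD; have -> : (x / 2 + x / 2) / 2 = x / 2 by field.
  by rewrite expr2; apply: ler_pM => //; lra.
have ex := expR_gt0 x.
rewrite -[leLHS]mul1r ler_pdivrMr //.
apply: (@le_trans _ _ ((1 - x + 3 / 4 * x ^+ 2) * (1 + x / 2) ^+ 2)).
  have -> : (1 - x + 3 / 4 * x ^+ 2) * (1 + x / 2) ^+ 2 =
    1 + x ^+ 3 / 2 + 3 / 16 * x ^+ 4 by field.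
  have := exprn_ge0 3 x0; have := exprn_ge0 4 x0; lra.
apply: ler_wpM2l => //.
by have := sqr_ge0 (x - 2 / 3); rewrite expr2; nra.
Qed.

Lemma expR_le_affine x : 0 <= x <= 1 / 2 -> expR x <= 1 + 2 * x.
Proof.
move=> /andP[x0 x1]; have e1 := expR_ge1Dx (- x); have ex := expR_gt0 x.
have eM : expR x * expR (- x) = 1 by rewrite expRN mulfV // gt_eqF.
have : expR x * (1 - x) <= expR x * expR (- x) by rewrite ler_pM2l.
rewrite eM.
have y0 : 0 < 1 - x by lra.
move=> H; rewrite -(ler_pM2r y0).
apply: (le_trans H); nra.
Qed.

Lemma expR1_ge2 : 2 <= expR 1 :> R.
Proof. by have := expR_ge1Dx (1 : R); lra. Qed.

End ExpBounds.

(** * Independence *)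

Section Independence.
Context (R : realType) (disp disp' : measure_display)
  (T : measurableType disp) (S : measurableType disp') (P : probability T R).
Implicit Types (Z : T -> S) (f : S -> R) (g : T -> R).

Import HBNNSimple.

Lemma integral_simple_comp Z g (h : {nnsfun S >-> R}) :
  measurable_fun setT Z -> measurable_fun setT g -> (forall t, 0 <= g t) ->
  (\int[P]_t (h (Z t) * g t)%:E =
   \sum_(k \in range h) k%:E * \int[P]_t (\1_(h @^-1` [set k]) (Z t) * g t)%:E)%E.
Proof.
move=> mZ mg g0.
have mind k : measurable_fun setT (fun t => \1_(h @^-1` [set k]) (Z t) * g t : R).
  by apply: measurable_funM => //; apply: measurableT_comp.
have ind0 k t : 0 <= \1_(h @^-1` [set k]) (Z t) * g t :> R.
  by rewrite mulr_ge0.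
transitivity (\int[P]_t \sum_(k \in range h)
    (k * (\1_(h @^-1` [set k]) (Z t) * g t))%:E)%E.
  apply: eq_integral => t _; rewrite fsumEFin //; congr EFin.
  rewrite [in LHS]fimfunE !(fsbig_finite _ _ (fimfunP h)) /= mulr_suml.
  by apply: eq_bigr => k _; rewrite mulrA.
rewrite ge0_integral_fsum //; last 2 first.
- by move=> k; apply/measurable_EFinP/measurable_funM.
- move=> k t _; rewrite lee_fin.
  have [k0|k0] := ltP k 0; last exact: mulr_ge0.
  by rewrite preimage_nnfun0 // indic0 mul0r mulr0.
apply: eq_fsbigr => k /[!inE] -[s _ hs].
under eq_integral do rewrite EFinM.
rewrite ge0_integralZl //.
- exact/measurable_EFinP.
- by move=> t _; rewrite lee_fin.
- by rewrite lee_fin -hs.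
Qed.

(** Two densities that integrate alike over every preimage under [Z] integrate
    alike against every function of [Z]: both sides are monotone limits of
    integrals of simple functions. *)
Lemma integral_comp_density Z g1 g2 f :
  measurable_fun setT Z -> measurable_fun setT f -> (forall s, 0 <= f s) ->
  measurable_fun setT g1 -> (forall t, 0 <= g1 t) ->
  measurable_fun setT g2 -> (forall t, 0 <= g2 t) ->
  (forall B : set S, measurable B ->
     \int[P]_t (\1_B (Z t) * g1 t)%:E = \int[P]_t (\1_B (Z t) * g2 t)%:E)%E ->
  (\int[P]_t (f (Z t) * g1 t)%:E = \int[P]_t (f (Z t) * g2 t)%:E)%E.
Proof.
move=> mZ mf f0 mg1 g10 mg2 g20 g12.
have mEf : measurable_fun setT (EFin \o f) by exact/measurable_EFinP.
pose h := nnsfun_approx measurableT mEf.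
have lim g : measurable_fun setT g -> (forall t, 0 <= g t) ->
  (\int[P]_t (f (Z t) * g t)%:E = limn (fun n => \int[P]_t (h n (Z t) * g t)%:E))%E.
  move=> mg g0; rewrite -monotone_convergence //.
  - apply: eq_integral => t _; apply/esym/cvg_lim => //.
    under eq_fun do rewrite EFinM.
    rewrite EFinM; apply: cvgeM; first by rewrite mule_def_fin.
      by apply: (cvg_nnsfun_approx measurableT mEf) => // s _; rewrite /= lee_fin.
    exact: cvg_cst.
  - move=> n; apply/measurable_EFinP/measurable_funM => //.
    exact: measurableT_comp.
  - by move=> n t _; rewrite lee_fin mulr_ge0.
  - move=> t _ m n mn; rewrite lee_fin ler_wpM2r //.
    exact/lefP/nd_nnsfun_approx.
rewrite !lim //; congr (limn _); apply/funext => n.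
rewrite !integral_simple_comp //; apply: eq_fsbigr => k _.
by rewrite g12.
Qed.

Lemma identically_distributed_integral Z Z' f :
  measurable_fun setT Z -> measurable_fun setT Z' ->
  identically_distributed P Z Z' ->
  measurable_fun setT f -> (forall s, 0 <= f s) ->
  (\int[P]_t (f (Z t))%:E = \int[P]_t (f (Z' t))%:E)%E.
Proof.
move=> mZ mZ' idZ mf f0.
have mEf : measurable_fun setT (EFin \o f) by exact/measurable_EFinP.
have f0' : {in setT, forall y, (0 <= (EFin \o f) y)%E}.
  by move=> s _; rewrite lee_fin.
have := ge0_integral_pushforward mZ P measurableT mEf f0'.
have := ge0_integral_pushforward mZ' P measurableT mEf f0'.
rewrite !preimage_setT => <- <-.
apply: eq_measure_integral => B mB _; exact: idZ.
Qed.

(** The definition of independence is the case where all the [f i] are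
    indicators.  They are replaced by general functions one index at a time: the
    product of the other factors is a density which, on preimages under [V i0],
    integrates like a constant, and [integral_comp_density] extends this from
    indicators to [f i0]. *)
Lemma mutually_independent_integral_prod (I : finType) (V : I -> T -> S)
    (f : I -> S -> R) (m : I -> R) :
  (forall i, measurable_fun setT (V i)) -> mutually_independent P V ->
  (forall i, measurable_fun setT (f i)) -> (forall i s, 0 <= f i s) ->
  (forall i, \int[P]_t (f i (V i t))%:E = (m i)%:E)%E ->
  (\int[P]_t (\prod_i f i (V i t))%:E = (\prod_i m i)%:E)%E.
Proof.
move=> mV indep mf f0 fm.
  (* phi s B has the functions f at the indices in s, indicators elsewhere *)
pose phi (s : seq I) (B : I -> set S) i :=
  if i \in s then f i else \1_(B i) : S -> R.
pose mu (s : seq I) (B : I -> set S) i :=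
  if i \in s then m i else fine (P (V i @^-1` B i)).
have mpre i B : measurable B -> measurable (V i @^-1` B).
  by move=> mB; rewrite -[X in measurable X]setTI; exact: mV.
have Pfin i B : measurable B -> (fine (P (V i @^-1` B)))%:E = P (V i @^-1` B).
  by move=> mB; rewrite fineK // fin_num_measure //; exact: mpre.
suff H s B : (forall i, measurable (B i)) ->
    (\int[P]_t (\prod_i phi s B i (V i t))%:E = (\prod_i mu s B i)%:E)%E.
  have := H (enum I) (fun=> setT) (fun=> measurableT).
  under eq_integral do under eq_bigr do rewrite /phi mem_enum.
  by under [in X in _ = X -> _]eq_bigr do rewrite /mu mem_enum.
elim: s B => [|i0 s IH] B mB.
  have -> : (\prod_i mu [::] B i)%:E = P (\bigcap_(i in [set` [set: I]%SET]) (V i @^-1` B i)).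
    rewrite (indep [set: I]%SET B mB).
    rewrite [RHS](_ : _ = (\prod_i P (V i @^-1` B i))%E); last first.
      by apply: eq_bigl => i; rewrite inE.
    elim/big_ind2 : _ => // [x x' y y' <- <-|i _]; first by rewrite EFinM.
    by rewrite /mu Pfin.
  rewrite -[X in P X]setIT -integral_indic //; last first.
    apply: fin_bigcap_measurable => //.
    by move=> i _; exact: mpre.
  apply: eq_integral => t _; congr EFin.
  rewrite indicE; case: (pselect ((\bigcap_(i in [set` [set: I]%SET]) (V i @^-1` B i)) t)) => Bt.
    rewrite mem_set // big1 // => i _.
    by rewrite /phi /= indicE mem_set //; apply: Bt; rewrite /= inE.
  rewrite memNset //.
  have [i Bi] : exists i, ~ B i (V i t).
    by apply/existsNP => Bt'; apply: Bt => i _; exact: Bt'.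
  by rewrite (bigD1 i) //= /phi /= indicE memNset // mul0r.
have [i0s|i0s] := boolP (i0 \in s).
  have E i : (i \in i0 :: s) = (i \in s).
    by rewrite inE; case: eqP => // ->; rewrite i0s.
  have := IH B mB; rewrite /phi /mu.
  under eq_integral do under eq_bigr do rewrite -E.
  by under [in X in _ = X -> _]eq_bigr do rewrite -E.
pose g t := \prod_(i | i != i0) phi s B i (V i t).
pose c := \prod_(i | i != i0) mu s B i.
have phi0 s' B' i x : 0 <= phi s' B' i x by rewrite /phi; case: ifP.
have mphi s' B' i : (forall i, measurable (B' i)) -> measurable_fun setT (phi s' B' i).
  by move=> mB'; rewrite /phi; case: ifP.
have mg s' B' : (forall i, measurable (B' i)) ->
    measurable_fun setT (fun t => \prod_(i | i != i0) phi s' B' i (V i t)).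
  move=> mB'; under eq_fun do rewrite big_mkcond.
  apply: measurable_prod => i _; case: (i != i0) => /=; last exact: measurable_cst.
  by apply: measurableT_comp => //; exact: mphi.
have g0 t : 0 <= g t by apply: prodr_ge0.
have c0 : 0 <= c.
  apply: prodr_ge0 => i _; rewrite /mu; case: ifP => _; last exact: fine_ge0.
  by rewrite -lee_fin -fm integral_ge0 // => t _; rewrite lee_fin.
have Phi t : \prod_i phi (i0 :: s) B i (V i t) = f i0 (V i0 t) * g t.
  rewrite (bigD1 i0) //= /phi mem_head; congr (_ * _).
  by apply: eq_bigr => i ii0; rewrite inE (negPf ii0).
have Mu : \prod_i mu (i0 :: s) B i = m i0 * c.
  rewrite (bigD1 i0) //= /mu mem_head; congr (_ * _).
  by apply: eq_bigr => i ii0; rewrite inE (negPf ii0).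
under eq_integral do rewrite Phi.
rewrite Mu (@integral_comp_density _ g (cst c)) //; last 2 first.
- exact: mg.
- move=> B' mB'; pose B'' i := if i == i0 then B' else B i.
  have mB'' i : measurable (B'' i) by rewrite /B''; case: ifP.
  have := IH B'' mB''.
  have -> : \prod_i mu s B'' i = fine (P (V i0 @^-1` B')) * c.
    rewrite (bigD1 i0) //= /mu (negPf i0s) /B'' eqxx; congr (_ * _).
    by apply: eq_bigr => i ii0; rewrite (negPf ii0).
  have Phi'' t : \prod_i phi s B'' i (V i t) = \1_B' (V i0 t) * g t.
    rewrite (bigD1 i0) //= /phi (negPf i0s) /B'' eqxx; congr (_ * _).
    by apply: eq_bigr => i ii0; rewrite (negPf ii0).
  under eq_integral do rewrite Phi''.
  move=> ->; rewrite EFinM Pfin // muleC.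
  under eq_integral do rewrite /= mulrC EFinM.
  rewrite ge0_integralZl //; last first.
    apply/measurable_EFinP; apply: measurableT_comp => //.
  congr (_ * _)%E; rewrite -[X in P X]setIT -integral_indic //; last exact: mpre.
under eq_integral do rewrite /= mulrC EFinM.
rewrite ge0_integralZl //.
- by rewrite fm mulrC EFinM.
- by apply/measurable_EFinP; apply: measurableT_comp.
- by move=> t _; rewrite lee_fin.
Qed.

End Independence.

(** * Rounding to a lattice *)

Section Rounding.
Context (R : realType) (d N : nat).
Variables (a : 'I_N -> 'I_d -> R) (mu eta : R).
Hypotheses (mu0 : 0 <= mu) (eta0 : 0 < eta).
Implicit Types u v w : 'I_d -> R.

Definition shifted_form u : R :=
  \sum_i (\sum_j u j * a i j) ^+ 2 - mu * \sum_j u j ^+ 2.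

Lemma shifted_form_coord u j0 : exists q1 q0 : R, forall t,
  shifted_form (fun j => if j == j0 then t else u j) =
  (\sum_i a i j0 ^+ 2 - mu) * t ^+ 2 + q1 * t + q0.
Proof.
pose r i := \sum_(j | j != j0) u j * a i j.
pose c := \sum_(j | j != j0) u j ^+ 2.
exists (2 * \sum_i a i j0 * r i), (\sum_i r i ^+ 2 - mu * c) => t.
rewrite /shifted_form [X in mu * X](bigD1 j0) //= eqxx.
under [X in mu * (_ + X)]eq_bigr => j jj0 do rewrite (negPf jj0).
rewrite -/c.
have -> : \sum_i (\sum_j (if j == j0 then t else u j) * a i j) ^+ 2 =
    \sum_i (t ^+ 2 * a i j0 ^+ 2 + 2 * t * (a i j0 * r i) + r i ^+ 2).
  apply: eq_bigr => i _; rewrite (bigD1 j0) //= eqxx.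
  under eq_bigr => j jj0 do rewrite (negPf jj0).
  by rewrite -/(r i); ring.
rewrite !big_split /= -!mulr_sumr; ring.
Qed.

(** Along one coordinate the form is a quadratic polynomial with leading
    coefficient at most [\sum_i a i j0 ^+ 2], because [mu] is nonnegative.  The
    average of its values at the two neighbouring lattice points, weighted so that
    the mean is [u j0], exceeds the value at [u j0] by the leading coefficient
    times the product of the two distances, hence by at most [eta^2 / 4] times
    it; the better of the two points does no worse than the average. *)
Lemma shifted_form_round_coord u j0 : exists k : int,
  `|eta * k%:~R - u j0| <= eta /\
  shifted_form (fun j => if j == j0 then eta * k%:~R else u j) <=
  shifted_form u + eta ^+ 2 / 4 * \sum_i a i j0 ^+ 2.
Proof.
have [q1 [q0 qE]] := shifted_form_coord u j0.
set s := \sum_i _ in qE *.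
have s0 : 0 <= s by apply: sumr_ge0 => i _; exact: sqr_ge0.
have uE : shifted_form u = (s - mu) * u j0 ^+ 2 + q1 * u j0 + q0.
  rewrite -qE; congr shifted_form; apply/funext => j.
  by case: eqP => // ->.
pose k := Num.floor (u j0 / eta); pose t1 := eta * k%:~R; pose t2 := t1 + eta.
have t1u : t1 <= u j0.
  by rewrite /t1 mulrC -ler_pdivlMr // floor_le.
have ut2 : u j0 < t2.
  rewrite /t2 /t1 -[X in _ + X]mulr1 -mulrDr mulrC -ltr_pdivrMr //.
  by rewrite -intrD1 floorD1_gt.
have t2E : t2 = eta * (k + 1)%:~R by rewrite intrD1 mulrDr mulr1.
pose M := shifted_form u + eta ^+ 2 / 4 * s.
pose q t := (s - mu) * t ^+ 2 + q1 * t + q0.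
have prod_le : (u j0 - t1) * (t2 - u j0) <= eta ^+ 2 / 4.
  rewrite /t2; set x := u j0; have := sqr_ge0 (2 * (x - t1) - eta); nra.
have prod_ge : 0 <= (u j0 - t1) * (t2 - u j0) by rewrite mulr_ge0 //; lra.
have avg : (t2 - u j0) * q t1 + (u j0 - t1) * q t2 <= eta * M.
  have -> : (t2 - u j0) * q t1 + (u j0 - t1) * q t2 =
     eta * (shifted_form u + (s - mu) * ((u j0 - t1) * (t2 - u j0))).
    by rewrite uE /q /t2; ring.
  rewrite ler_pM2l // /M lerD2l.
  apply: (@le_trans _ _ (s * ((u j0 - t1) * (t2 - u j0)))).
    by rewrite ler_wpM2r // gerBl.
  by rewrite mulrC ler_wpM2r.
have [q1M|q1M] := lerP (q t1) M.
  exists k; split; first by rewrite -/t1 ler_norml; apply/andP; split; rewrite /t2 in ut2; lra.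
  by rewrite qE.
exists (k + 1); split.
  by rewrite -t2E ler_norml; apply/andP; split; rewrite /t2 in ut2 *; lra.
rewrite qE -t2E -/(q t2) -/M leNgt; apply/negP => q2M.
have p1 : 0 < (t2 - u j0) * (q t1 - M) by rewrite mulr_gt0 //; lra.
have p2 : 0 <= (u j0 - t1) * (q t2 - M) by rewrite mulr_ge0 //; lra.
have : 0 < (t2 - u j0) * (q t1 - M) + (u j0 - t1) * (q t2 - M) by lra.
have -> : (t2 - u j0) * (q t1 - M) + (u j0 - t1) * (q t2 - M) =
   (t2 - u j0) * q t1 + (u j0 - t1) * q t2 - eta * M by rewrite /t2; ring.
lra.
Qed.

Lemma shifted_form_round w : exists k : 'I_d -> int,
  (forall j, `|eta * (k j)%:~R - w j| <= eta) /\
  shifted_form (fun j => eta * (k j)%:~R) <=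
  shifted_form w + eta ^+ 2 / 4 * \sum_j \sum_i a i j ^+ 2.
Proof.
suff H (s : seq 'I_d) : uniq s -> exists k : 'I_d -> int,
    (forall j, j \in s -> `|eta * (k j)%:~R - w j| <= eta) /\
    shifted_form (fun j => if j \in s then eta * (k j)%:~R else w j) <=
    shifted_form w + eta ^+ 2 / 4 * \sum_(j <- s) \sum_i a i j ^+ 2.
  have [k [k1 k2]] := H _ (index_enum_uniq 'I_d).
  exists k; split; first by move=> j; apply: k1; rewrite mem_index_enum.
  move: k2; congr (_ <= _); congr shifted_form; apply/funext => j.
  by rewrite mem_index_enum.
elim: s => [_|j0 s IH /= /andP[j0s us]].
  by exists (fun=> 0); split => //; rewrite big_nil [_ / 4 * _]mulr0 addr0.
have [k [k1 k2]] := IH us.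
have [k0 [k3 k4]] := shifted_form_round_coord
  (fun j => if j \in s then eta * (k j)%:~R else w j) j0.
exists (fun j => if j == j0 then k0 else k j); split.
  move=> j; rewrite inE; case: eqP => [-> _|_ /=]; last exact: k1.
  by move: k3; rewrite (negPf j0s).
rewrite big_cons mulrDr addrCA addrA addrAC -addrA [_ + shifted_form _]addrC.
have -> : (fun j => if j \in j0 :: s
      then eta * (if j == j0 then k0 else k j)%:~R else w j) =
   (fun j => if j == j0 then eta * k0%:~R else
             if j \in s then eta * (k j)%:~R else w j).
  by apply/funext => j; rewrite inE; case: eqP.
apply: (le_trans k4); lra.
Qed.

End Rounding.

Lemma binomial_le_expn n k : ('C(n, k) <= 2 ^ n)%N.
Proof.
have [kn|kn] := leqP k n; last by rewrite bin_small.
have -> : (2 ^ n = \sum_(i < n.+1) 'C(n, i))%N.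
  have := expnDn 1 1 n => /= ->; apply: eq_bigr => i _.
  by rewrite !exp1n !muln1.
by rewrite (bigD1 (Ordinal (kn : (k < n.+1)%N))) //= leq_addr.
Qed.

(** Integer vectors of l1-norm at most [m], encoded by signs and magnitudes (a zero
    coordinate has two codes).  The magnitudes are counted by a binomial
    coefficient. *)
Lemma card_l1_ball d m :
  (#|[set q : {ffun 'I_d -> bool} * d.-tuple 'I_m.+1 | (\sum_(j <- q.2) j <= m)%N]%SET|
     <= 2 ^ (2 * d + m))%N.
Proof.
have -> : [set q : {ffun 'I_d -> bool} * d.-tuple 'I_m.+1 | (\sum_(j <- q.2) j <= m)%N]%SET
   = finset.setX [set: {ffun 'I_d -> bool}]%SET
        [set q : d.-tuple 'I_m.+1 | (\sum_(j <- q) j <= m)%N]%SET.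
  by apply/setP => -[e q]; rewrite !inE.
rewrite cardsX cardsT card_ffun card_bool card_ord card_partial_ord_partitions.
by rewrite mul2n -addnn -addnA expnD leq_mul2l binomial_le_expn orbT.
Qed.

(** * Lower tail of an empirical second moment *)

Section LowerTail.
Context (R : realType) (disp disp' : measure_display)
  (T : measurableType disp) (S : measurableType disp') (P : probability T R).
Context (n d : nat) (V0 : T -> S) (V : 'I_n -> T -> S).
Hypotheses (mV0 : measurable_fun setT V0)
  (mV : forall i, measurable_fun setT (V i))
  (idV : forall i, identically_distributed P (V i) V0)
  (indepV : mutually_independent P V).

Lemma chernoff (g : S -> R) (a m : R) :
  measurable_fun setT g -> (forall s, 0 <= g s) -> 0 < a ->
  mean P (g \o V0) = m%:E ->
  (P [set t | (a <= \prod_i g (V i t))%R] <= (m ^+ n / a)%:E)%E.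
Proof.
move=> mg g0 a0 gm; apply: markov_ge0 => //.
- apply: measurable_prod => i _; exact: measurableT_comp.
- by move=> t; apply: prodr_ge0.
have gm' i : (\int[P]_t (g (V i t))%:E = m%:E)%E.
  by rewrite (identically_distributed_integral (mV i) mV0 (idV i)).
rewrite /mean (mutually_independent_integral_prod mV indepV (f := fun=> g) (m := fun=> m)) //.
by rewrite prodr_const card_ord.
Qed.

Variables (z : 'I_d -> S -> R) (kappa : R).
Hypotheses (mz : forall j, measurable_fun setT (z j)) (d0 : (0 < d)%N)
  (kappa0 : 0 < kappa).

Definition lin (u : 'I_d -> R) (s : S) : R := \sum_j u j * z j s.
Definition normsq (u : 'I_d -> R) : R := \sum_j u j ^+ 2.

Hypothesis second : forall u, mean P (fun t => lin u (V0 t) ^+ 2) = (normsq u)%:E.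
Hypothesis fourth : forall u,
  (mean P (fun t => lin u (V0 t) ^+ 4)%R <= (kappa * normsq u ^+ 2)%:E)%E.

Let radius2 : R := 4 * kappa * d%:R.
(** Indicator of the observations that are not discarded.  Dropping the others
    only decreases the empirical second moment, and leaves a bounded trace, for
    which an upper tail bound is available. *)
Definition kept (s : S) : R := (normsq (z ^~ s) <= radius2)%R%:R.

Let dR : 0 < d%:R :> R. Proof. by rewrite ltr0n. Qed.
Let radius2_gt0 : 0 < radius2. Proof. by rewrite /radius2 !mulr_gt0. Qed.

Lemma normsq_ge0 u : 0 <= normsq u.
Proof. by apply: sumr_ge0 => j _; exact: sqr_ge0. Qed.

Lemma measurable_lin u : measurable_fun setT (lin u).
Proof. by apply: measurable_sum => j; apply: measurable_funM. Qed.

Lemma measurable_normsq : measurable_fun setT (fun s => normsq (z ^~ s)).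
Proof. by apply: measurable_sum => j; apply: measurable_funX. Qed.

Lemma kept_ge0 s : 0 <= kept s. Proof. exact: ler0n. Qed.
Lemma kept_le1 s : kept s <= 1. Proof. by rewrite /kept lern1 leq_b1. Qed.
Lemma kept_sqr s : kept s ^+ 2 = kept s.
Proof. by rewrite /kept; case: (_ <= _); rewrite ?expr1n ?expr0n. Qed.

Lemma measurable_kept : measurable_fun setT kept.
Proof.
have -> : kept = \1_[set s | normsq (z ^~ s) <= radius2].
  apply/funext => s; rewrite /kept indicE.
  have [h|h] := boolP (_ <= _); first by rewrite mem_set.
  by rewrite memNset //=; move: h => /negP.
apply: measurable_indic.
have -> : [set s | normsq (z ^~ s) <= radius2] =
    [set s | - radius2 <= - normsq (z ^~ s)].
  by apply/seteqP; split => s /=; rewrite lerN2.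
exact/measurable_ler_set/measurable_funN/measurable_normsq.
Qed.

Let mlin u : measurable_fun setT (fun t => lin u (V0 t)).
Proof. by apply: (measurableT_comp (f := lin u)) => //; exact: measurable_lin. Qed.
Let mlin4 u : measurable_fun setT (fun t => lin u (V0 t) ^+ 4).
Proof. exact: measurable_funX. Qed.
Let mkept : measurable_fun setT (fun t => kept (V0 t)).
Proof. by apply: (measurableT_comp (f := kept)) => //; exact: measurable_kept. Qed.
Let mlin2k u : measurable_fun setT (fun t => lin u (V0 t) ^+ 2 * kept (V0 t)).
Proof. by apply: measurable_funM => //; exact: measurable_funX. Qed.
Let lin4_ge0 u s : 0 <= lin u s ^+ 4.
Proof. by rewrite (_ : 4 = 2 * 2)%N // exprM sqr_ge0. Qed.

Lemma lin_delta j s : lin (fun i => (i == j)%:R) s = z j s.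
Proof.
rewrite /lin (bigD1 j) //= eqxx mul1r big1 ?addr0 // => i ij.
by rewrite (negPf ij) mul0r.
Qed.

Lemma normsq_delta j : normsq (fun i => (i == j)%:R) = 1.
Proof.
rewrite /normsq (bigD1 j) //= eqxx expr1n big1 ?addr0 // => i ij.
by rewrite (negPf ij) expr0n.
Qed.

(** Where the observation is discarded, [1 <= |z|^2 / radius2], so the loss is at
    most [\sum_j E (<u,z>^2 z_j^2) / radius2].  The inequality between arithmetic
    and geometric means, weighted by [c = |u|^2], bounds each term by the fourth
    moments of [<u,z>] and [z_j], and the sum by [kappa d |u|^2 / radius2]. *)
Lemma mean_truncated_ge u : exists2 r,
  mean P (fun t => lin u (V0 t) ^+ 2 * kept (V0 t)) = r%:E & 3 / 4 * normsq u <= r.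
Proof.
have [c0|c0] := leP (normsq u) 0.
  have [||r rE /andP[r0 _]] := @mean_fin _ _ _ P
    (fun t => lin u (V0 t) ^+ 2 * kept (V0 t)) (normsq u) (mlin2k u).
  - by move=> t; rewrite mulr_ge0 ?sqr_ge0 ?kept_ge0.
  - rewrite -second; apply: mean_le => //; first exact: measurable_funX.
      by move=> t; rewrite mulr_ge0 ?sqr_ge0 ?kept_ge0.
    by move=> t; rewrite ler_piMr ?sqr_ge0 ?kept_le1.
  by exists r => //; lra.
set c := normsq u in c0 *.
have [||r rE /andP[r0 _]] := @mean_fin _ _ _ P
    (fun t => lin u (V0 t) ^+ 2 * kept (V0 t)) c (mlin2k u).
- by move=> t; rewrite mulr_ge0 ?sqr_ge0 ?kept_ge0.
- rewrite -second; apply: mean_le => //; first exact: measurable_funX.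
    by move=> t; rewrite mulr_ge0 ?sqr_ge0 ?kept_ge0.
  by move=> t; rewrite ler_piMr ?sqr_ge0 ?kept_le1.
exists r => //.
pose b := (2 * radius2)^-1.
have b0 : 0 < b by rewrite invr_gt0 mulr_gt0.
pose F t : R := \sum_(j < d) (c^-1 * lin u (V0 t) ^+ 4 + c * z j (V0 t) ^+ 4).
have c0' := ltW c0; have ci0 : 0 <= c^-1 by rewrite invr_ge0.
have z40 j t : 0 <= z j (V0 t) ^+ 4 by rewrite -(lin_delta j).
have Fj0 j t : 0 <= c^-1 * lin u (V0 t) ^+ 4 + c * z j (V0 t) ^+ 4.
  by apply: addr_ge0; apply: mulr_ge0.
have F0 t : 0 <= F t by apply: sumr_ge0 => j _; exact: Fj0.
have mzj j : measurable_fun setT (fun t => z j (V0 t) ^+ 4).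
  by apply: measurable_funX; exact: measurableT_comp.
have mFj j : measurable_fun setT
    (fun t => c^-1 * lin u (V0 t) ^+ 4 + c * z j (V0 t) ^+ 4).
  by apply: measurable_funD; apply: measurable_funM.
have mF : measurable_fun setT F by exact: measurable_sum.
have pointwise t : lin u (V0 t) ^+ 2 <= lin u (V0 t) ^+ 2 * kept (V0 t) + b * F t.
  have bF0 : 0 <= b * F t by rewrite mulr_ge0 // ltW.
  rewrite /kept; case: (lerP (normsq _) radius2) => h; first by rewrite mulr1; lra.
  rewrite mulr0 add0r /b mulrC ler_pdivlMr ?mulr_gt0 //.
  set x := lin u _ ^+ 2 in bF0 *.
  have x0 : 0 <= x by exact: sqr_ge0.
  apply: (@le_trans _ _ (2 * (x * normsq (z ^~ (V0 t))))).
    by rewrite mulrCA ler_wpM2l // ler_wpM2l // ltW.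
  rewrite /normsq !mulr_sumr; apply: ler_sum => j _.
  have -> : lin u (V0 t) ^+ 4 = x ^+ 2 by rewrite -exprM.
  set y := z j _ ^+ 2; have -> : z j (V0 t) ^+ 4 = y ^+ 2 by rewrite -exprM.
  have := mulr_ge0 (ltW (_ : 0 < c^-1)) (sqr_ge0 (x - c * y)).
  rewrite invr_gt0 => /(_ c0).
  have -> : c^-1 * (x - c * y) ^+ 2 = c^-1 * x ^+ 2 + c * y ^+ 2 - 2 * (x * y).
    by field; rewrite gt_eqF.
  lra.
have meanF : (mean P F <= (2 * d%:R * kappa * c)%:E)%E.
  rewrite mean_sum //.
  apply: (@le_trans _ _ (\sum_(j < d) (2 * kappa * c)%:E)%E); last first.
    by rewrite sumEFin sumr_const card_ord lee_fin -mulr_natr; lra.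
  apply: lee_sum => j _.
  rewrite meanD; first last.
  - by move=> t; exact: mulr_ge0.
  - by move=> t; exact: mulr_ge0.
  - exact: measurable_funM.
  - exact: measurable_funM.
  rewrite !meanZ //.
  have -> : (2 * kappa * c)%:E = (c^-1%:E * (kappa * c ^+ 2)%:E + c%:E * kappa%:E)%E.
    by rewrite -!EFinM -EFinD; congr EFin; field; rewrite gt_eqF.
  apply: leeD; first by apply: lee_wpmul2l; [rewrite lee_fin | exact: fourth].
  apply: lee_wpmul2l; first by rewrite lee_fin.
  have := fourth (fun i => (i == j)%:R).
  rewrite normsq_delta expr1n mulr1; apply: le_trans.
  by under [in leRHS]eq_mean do rewrite lin_delta.
have bF0 t : 0 <= b * F t by apply: mulr_ge0 => //; exact: ltW.
have mbF : measurable_fun setT (fun t => b * F t) by exact: measurable_funM.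
have k0 t : 0 <= lin u (V0 t) ^+ 2 * kept (V0 t).
  by rewrite mulr_ge0 ?sqr_ge0 ?kept_ge0.
have H : (c%:E <= r%:E + b%:E * mean P F)%E.
  rewrite -rE -(meanZ P mF F0 (ltW b0)) -meanD // -second.
  apply: mean_le => //; first exact: measurable_funX.
    exact: measurable_funD.
  by move=> t; exact: sqr_ge0.
have {}H : (c%:E <= r%:E + b%:E * (2 * d%:R * kappa * c)%:E)%E.
  by apply: (le_trans H); rewrite leeD2l // lee_wpmul2l // lee_fin ltW.
move: H; rewrite -EFinM -EFinD lee_fin.
have -> : b * (2 * d%:R * kappa * c) = c / 4.
  by rewrite /b /radius2; field; rewrite !gt_eqF.
lra.
Qed.

(** For the exponent [x = <u,z>^2 / (4 kappa |u|^2)] the quadratic bound on [exp (-x)]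
    has expectation at most [1 - 3/(16 kappa) + 3/(64 kappa)]. *)
Lemma lower_mgf u : 0 < normsq u -> exists2 m,
  mean P ((fun s => expR (- ((4 * kappa * normsq u)^-1 * (lin u s ^+ 2 * kept s))))
    \o V0) = m%:E & 0 <= m <= expR (- (9 / (64 * kappa))).
Proof.
set c := normsq u => c0; set th := (4 * kappa * c)^-1.
have th0 : 0 < th by rewrite invr_gt0 !mulr_gt0.
pose g s := expR (- (th * (lin u s ^+ 2 * kept s))).
have Y0 s : 0 <= lin u s ^+ 2 * kept s by rewrite mulr_ge0 ?sqr_ge0 ?kept_ge0.
have thY0 s : 0 <= th * (lin u s ^+ 2 * kept s) by apply: mulr_ge0 => //; exact: ltW.
have mgV : measurable_fun setT (g \o V0).
  apply: (measurableT_comp (f := @expR R)) => //; apply: measurable_funN.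
  by apply: measurable_funM => //; exact: mlin2k.
have g0 t : 0 <= (g \o V0) t by exact: expR_ge0.
have [|m mE /andP[m0 _]] := @mean_fin _ _ _ P (g \o V0) 1 mgV g0.
  rewrite -(mean_cst P 1); apply: mean_le => // t.
  by rewrite /= -expR0 ler_expR oppr_le0.
exists m => //; rewrite m0 /=.
have [r rE r_ge] := mean_truncated_ge u.
have H : (mean P (fun t => (g \o V0) t + th * (lin u (V0 t) ^+ 2 * kept (V0 t)))%R
   <= mean P (fun t => 1 + 3 / 4 * th ^+ 2 * lin u (V0 t) ^+ 4)%R)%E.
  apply: mean_le.
  - by apply: measurable_funD => //; exact: measurable_funM.
  - by apply: measurable_funD => //; exact: measurable_funM.
  - by move=> t; apply: addr_ge0.
  - move=> t; rewrite /g /=; set Y := _ * kept _.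
    have := expRN_le_quadratic (thY0 (V0 t)); rewrite -/Y.
    have : (th * Y) ^+ 2 <= th ^+ 2 * lin u (V0 t) ^+ 4.
      rewrite exprMn ler_wpM2l ?sqr_ge0 // /Y exprMn kept_sqr -exprM.
      by rewrite ler_piMr // kept_le1.
    lra.
have c34 : 0 <= 3 / 4 * th ^+ 2 by rewrite mulr_ge0 ?sqr_ge0 //; lra.
move: H; rewrite meanD //; last by exact: measurable_funM.
rewrite (meanZ P (mlin2k u) (fun t => Y0 (V0 t)) (ltW th0)) rE mE meanD //; first last.
- by move=> t; apply: mulr_ge0.
- exact: measurable_funM.
rewrite mean_cst (meanZ P (mlin4 u)) // => H.
have {}H : (m%:E + th%:E * r%:E <= 1%:E + (3 / 4 * th ^+ 2)%:E * (kappa * c ^+ 2)%:E)%E.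
  by apply: (le_trans H); rewrite leeD2l // lee_wpmul2l // ?lee_fin //; exact: fourth.
move: H; rewrite -!EFinM -!EFinD lee_fin => H.
have H2 : th * (3 / 4 * c) <= th * r by rewrite ler_wpM2l // ltW.
have E1 : th * (3 / 4 * c) = 3 / (16 * kappa).
  by rewrite /th; field; rewrite !gt_eqF.
have E2 : 3 / 4 * th ^+ 2 * (kappa * c ^+ 2) = 3 / (64 * kappa).
  by rewrite /th; field; rewrite !gt_eqF.
have E3 : 1 - 3 / (16 * kappa) + 3 / (64 * kappa) = 1 + - (9 / (64 * kappa)).
  by field; rewrite gt_eqF.
apply: le_trans (expR_ge1Dx _); lra.
Qed.

(** On the kept observations the exponent is at most [1/2], where the exponential
    is below [1 + 2 x]. *)
Lemma trace_mgf : exists2 m,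
  mean P ((fun s => expR ((2 * radius2)^-1 * (normsq (z ^~ s) * kept s))) \o V0)
    = m%:E & 0 <= m <= expR (4 * kappa)^-1.
Proof.
set th := (2 * radius2)^-1.
have th0 : 0 < th by rewrite invr_gt0 !mulr_gt0.
pose g s := expR (th * (normsq (z ^~ s) * kept s)).
have mN : measurable_fun setT (fun t => normsq (z ^~ (V0 t))).
  apply: (measurableT_comp (f := fun s => normsq (z ^~ s))) => //.
  exact: measurable_normsq.
have mgV : measurable_fun setT (g \o V0).
  apply: (measurableT_comp (f := @expR R)) => //.
  by apply: measurable_funM => //; exact: measurable_funM.
have g0 t : 0 <= (g \o V0) t by exact: expR_ge0.
have th20 : 0 <= 2 * th by rewrite mulr_ge0 // ltW.
have mz2 j : measurable_fun setT (fun t => z j (V0 t) ^+ 2).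
  by apply: measurable_funX; exact: measurableT_comp.
have H : (mean P (g \o V0) <= (expR (4 * kappa)^-1)%:E)%E.
  apply: (@le_trans _ _ (mean P (fun t => 1 + 2 * th * normsq (z ^~ (V0 t))))).
    apply: mean_le => //.
      by apply: measurable_funD => //; exact: measurable_funM.
    move=> t; rewrite /g /=; set N := normsq _.
    have N0 : 0 <= N by exact: normsq_ge0.
    rewrite /kept -/N; case: (lerP N radius2) => h.
      rewrite mulr1 -mulrA; apply: expR_le_affine; apply/andP; split.
        by rewrite mulr_ge0 // ltW.
      by rewrite /th invfM -mulrA mul1r ler_piMr // mulrC ler_pdivrMr ?mul1r.
    by rewrite mulr0 mulr0 expR0 lerDl mulr_ge0.
  rewrite meanD //; first last.
  - by move=> t; rewrite mulr_ge0 // normsq_ge0.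
  - exact: measurable_funM.
  rewrite mean_cst (meanZ P mN) //; last by move=> t; exact: normsq_ge0.
  rewrite mean_sum //; last by move=> j t; exact: sqr_ge0.
  have -> : (\sum_j mean P (fun t => (z j (V0 t) ^+ 2)%R) = d%:R%:E)%E.
    rewrite (eq_bigr (fun=> 1%:E)); first by rewrite sumEFin sumr_const card_ord.
    move=> j _; have := second (fun i => (i == j)%:R).
    rewrite normsq_delta => <-; apply: eq_mean => t; by rewrite lin_delta.
  rewrite -EFinM -EFinD lee_fin; apply: le_trans (expR_ge1Dx _).
  by rewrite lerD2l /th /radius2 le_eqVlt; apply/orP; left; apply/eqP; field; rewrite !gt_eqF.
by have [m mE m0] := mean_fin mgV g0 H; exists m.
Qed.

Lemma expR_sumZ (a : R) (y : 'I_n -> R) :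
  \prod_i expR (a * y i) = expR (a * \sum_i y i).
Proof. by rewrite mulr_sumr expR_sum. Qed.

(** Chernoff's bound with the exponent of [lower_mgf]: per observation the loss is
    [5/64 - 9/64 = -1/16], divided by [kappa]. *)
Lemma lower_prob u :
  (P [set t | (\sum_i lin u (V i t) ^+ 2 * kept (V i t) < n%:R * (5 / 16 * normsq u))%R]
   <= (expR (- (n%:R / (16 * kappa))))%:E)%E.
Proof.
have [c0|c0] := leP (normsq u) 0.
  have -> : normsq u = 0 by apply/eqP; rewrite eq_le c0 normsq_ge0.
  rewrite mulr0 mulr0 (_ : [set t | _] = set0) ?measure0 ?lee_fin ?expR_ge0 //.
  apply/seteqP; split => t //=; rewrite ltNge; apply: contraNP => _.
  by apply: sumr_ge0 => i _; rewrite mulr_ge0 ?sqr_ge0 ?kept_ge0.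
set c := normsq u in c0 *; set th := (4 * kappa * c)^-1.
have th0 : 0 < th by rewrite invr_gt0 !mulr_gt0.
have [m mE /andP[m0 m1]] := lower_mgf c0.
have mg : measurable_fun setT (fun s => expR (- (th * (lin u s ^+ 2 * kept s)))).
  apply: (measurableT_comp (f := @expR R)) => //; apply: measurable_funN.
  apply: measurable_funM => //; apply: measurable_funM; last exact: measurable_kept.
  by apply: measurable_funX; exact: measurable_lin.
have := chernoff mg (fun=> expR_ge0 _) (expR_gt0 (- th * (n%:R * (5 / 16 * c)))) mE.
move=> H; apply: le_trans (le_trans H _).
  apply: le_measure.
  - rewrite inE; apply: measurable_ltr_set; apply: measurable_sum => i.
    apply: measurable_funM; last by apply: (measurableT_comp measurable_kept).
    by apply: measurable_funX; apply: (measurableT_comp (measurable_lin u)).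
  - rewrite inE; apply: measurable_ler_set; apply: measurable_prod => i _.
    exact: (measurableT_comp mg).
  - move=> t /= ht; under eq_bigr do rewrite -mulNr.
    by rewrite expR_sumZ ler_expR ler_wnM2l ?oppr_le0 // ltW.
rewrite lee_fin -expRN ; apply: (@le_trans _ _
   (expR (- (9 / (64 * kappa))) ^+ n * expR (- (- th * (n%:R * (5 / 16 * c)))))).
  by rewrite ler_wpM2r ?expR_ge0 // lerXn2r // nnegrE expR_ge0.
rewrite -expRM_natl -expRD ler_expR le_eqVlt; apply/orP; left; apply/eqP.
by rewrite /th; field; rewrite !gt_eqF.
Qed.

Lemma trace_prob :
  (P [set t | (n%:R * (3 * d%:R) <= \sum_i normsq (z ^~ (V i t)) * kept (V i t))%R]
   <= (expR (- (n%:R / (8 * kappa))))%:E)%E.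
Proof.
set th := (2 * radius2)^-1.
have th0 : 0 < th by rewrite invr_gt0 !mulr_gt0.
have [m mE /andP[m0 m1]] := trace_mgf.
have mg : measurable_fun setT (fun s => expR (th * (normsq (z ^~ s) * kept s))).
  apply: (measurableT_comp (f := @expR R)) => //.
  apply: measurable_funM => //; apply: measurable_funM; last exact: measurable_kept.
  exact: measurable_normsq.
have := chernoff mg (fun=> expR_ge0 _) (expR_gt0 (th * (n%:R * (3 * d%:R)))) mE.
move=> H; apply: le_trans (le_trans H _).
  apply: le_measure.
  - rewrite inE; apply: measurable_ler_set; apply: measurable_sum => i.
    apply: measurable_funM; last by apply: (measurableT_comp measurable_kept).
    exact: (measurableT_comp measurable_normsq).
  - rewrite inE; apply: measurable_ler_set; apply: measurable_prod => i _.
    exact: (measurableT_comp mg).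
  - by move=> t /= ht; rewrite expR_sumZ ler_expR ler_wpM2l // ltW.
rewrite lee_fin -expRN ; apply: (@le_trans _ _
   (expR (4 * kappa)^-1 ^+ n * expR (- (th * (n%:R * (3 * d%:R)))))).
  by rewrite ler_wpM2r ?expR_ge0 // lerXn2r // nnegrE expR_ge0.
rewrite -expRM_natl -expRD ler_expR le_eqVlt; apply/orP; left; apply/eqP.
by rewrite /th /radius2; field; rewrite !gt_eqF.
Qed.

Lemma probability_bigsetU_le (I : finType) (Q : pred I) (B : I -> set T) (b : R) :
  (forall i, measurable (B i)) -> (forall i, (P (B i) <= b%:E)%E) ->
  measurable (\big[setU/set0]_(i | Q i) B i) /\
  (P (\big[setU/set0]_(i | Q i) B i) <= (#|Q|%:R * b)%:E)%E.
Proof.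
move=> mB PB; rewrite -sum1_card natr_sum mulr_suml.
elim/big_rec2 : _ => [|i A y Qi [mA PA]]; first by rewrite measure0.
split; first exact: measurableU.
apply: (le_trans (measureU2 _ _ _)) => //.
by rewrite mul1r EFinD (leeD (PB i) PA).
Qed.

Definition grid : finType := ({ffun 'I_d -> bool} * d.-tuple 'I_(10 * d).+1)%type.

Definition signed (q : grid) (j : 'I_d) : R :=
  (-1) ^+ q.1 j * (tnth q.2 j)%:R.

(** The numbers fit as follows.  With [eta^2 = |u|^2 / (4 d)] the rounded vector
    has squared norm at most [2 |u|^2 + 2 d eta^2 = 10 d eta^2], hence integer
    coordinates [k] with [\sum_j |k j| <= \sum_j (k j)^2 <= 10 d].  Rounding costs
    [eta^2 / 4] times a trace below [3 n d], that is [3/16 n |u|^2], and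
    [5/16 - 3/16 = 1/8]. *)
Lemma lower_tail_pointwise t :
  \sum_i normsq (z ^~ (V i t)) * kept (V i t) < n%:R * (3 * d%:R) ->
  (forall q : grid, (\sum_(j <- q.2) j <= 10 * d)%N ->
    n%:R * (5 / 16 * normsq (signed q)) <=
    \sum_i lin (signed q) (V i t) ^+ 2 * kept (V i t)) ->
  forall u, n%:R / 8 * normsq u <= \sum_i lin u (V i t) ^+ 2.
Proof.
move=> tr low u.
have [u0|u0] := leP (normsq u) 0.
  have -> : normsq u = 0 by apply/eqP; rewrite eq_le u0 normsq_ge0.
  by rewrite mulr0; apply: sumr_ge0 => i _; exact: sqr_ge0.
pose a i j := z j (V i t) * kept (V i t).
pose mu := n%:R * (5 / 16) : R.
have mu0 : 0 <= mu by rewrite mulr_ge0 //; lra.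
pose eta := Num.sqrt (normsq u / (4 * d%:R)).
have eta0 : 0 < eta by rewrite sqrtr_gt0 divr_gt0 // mulr_gt0.
have eta2 : eta ^+ 2 = normsq u / (4 * d%:R).
  by rewrite sqr_sqrtr // divr_ge0 ?ltW // mulr_gt0.
have form w : shifted_form a mu w =
    \sum_i lin w (V i t) ^+ 2 * kept (V i t) - mu * normsq w.
  congr (_ - _); apply: eq_bigr => i _.
  rewrite -[in RHS]kept_sqr -exprMn /lin mulr_suml; congr (_ ^+ 2).
  by apply: eq_bigr => j _; rewrite mulrA.
have [k [k1 k2]] := shifted_form_round a mu0 eta0 u.
have kd : \sum_j ((k j)%:~R : R) ^+ 2 <= 10 * d%:R.
  have e20 : 0 < eta ^+ 2 by rewrite exprn_gt0.
  rewrite -(ler_pM2l e20) mulr_sumr.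
  apply: (@le_trans _ _ (\sum_j (2 * u j ^+ 2 + 2 * eta ^+ 2))).
    apply: ler_sum => j _; rewrite -exprMn; set x := eta * _.
    have : (x - u j) ^+ 2 <= eta ^+ 2.
      rewrite -sqr_normE lerXn2r // ?nnegrE ?normr_ge0 //; last exact: k1.
      exact: ltW.
    have := sqr_ge0 (x - 2 * u j); nra.
  rewrite big_split /= -mulr_sumr sumr_const card_ord -mulr_natr -/(normsq u).
  have -> : normsq u = 4 * d%:R * eta ^+ 2.
    by rewrite eta2; field; rewrite gt_eqF.
  lra.
have kN : (\sum_j `|k j| <= 10 * d)%N.
  rewrite -(ler_nat R) natr_sum natrM; apply: le_trans kd.
  apply: ler_sum => j _; have -> : (k j)%:~R ^+ 2 = (`|k j| ^ 2)%N%:R :> R.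
    by rewrite natrX natr_absz intr_norm sqr_normE.
  by rewrite ler_nat; case: (`|k j|)%N => // m; rewrite expnS expn1 leq_pmulr.
have kj j : (`|k j| < (10 * d).+1)%N.
  by rewrite ltnS; apply: leq_trans kN; rewrite (bigD1 j) //= leq_addr.
pose q : grid := ([ffun j => (k j < 0)%R], [tuple Ordinal (kj j) | j < d]).
have qE : signed q = fun j => (k j)%:~R.
  apply/funext => j; rewrite /signed /= ffunE tnth_mktuple /=.
  rewrite [RHS](_ : _ = ((-1) ^+ (k j < 0)%R * `|k j|%:Z)%:~R); last by rewrite -intEsign.
  by rewrite intrM rmorphXn /= mulrN1z.
have qN : (\sum_(j <- q.2) j <= 10 * d)%N.
  rewrite big_tuple (eq_bigr (fun j => `|k j|%N)) // => j _.
  by rewrite tnth_mktuple.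
have := low q qN; rewrite qE => lowk.
have etaS : shifted_form a mu (fun j => eta * (k j)%:~R) =
   eta ^+ 2 * (\sum_i lin (fun j => (k j)%:~R) (V i t) ^+ 2 * kept (V i t)
     - mu * normsq (fun j => (k j)%:~R)).
  rewrite form mulrBr; congr (_ - _).
    rewrite [RHS]mulr_sumr; apply: eq_bigr => i _; rewrite mulrA -exprMn /lin mulr_sumr; congr (_ ^+ 2 * _).
    by apply: eq_bigr => j _; rewrite mulrA.
  rewrite mulrCA; congr (_ * _); rewrite /normsq mulr_sumr.
  by apply: eq_bigr => j _; rewrite exprMn.
have pos : 0 <= shifted_form a mu (fun j => eta * (k j)%:~R).
  rewrite etaS mulr_ge0 ?sqr_ge0 // subr_ge0 /mu -mulrA; exact: lowk.
have traceE : \sum_j \sum_i a i j ^+ 2 =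
    \sum_i normsq (z ^~ (V i t)) * kept (V i t).
  rewrite exchange_big /=; apply: eq_bigr => i _; rewrite /normsq mulr_suml.
  by apply: eq_bigr => j _; rewrite /a exprMn kept_sqr.
rewrite traceE (form u) in k2.
have tr2 : eta ^+ 2 / 4 * \sum_i normsq (z ^~ (V i t)) * kept (V i t) <=
    n%:R * (3 / 16) * normsq u.
  apply: (@le_trans _ _ (eta ^+ 2 / 4 * (n%:R * (3 * d%:R)))).
    by apply: ler_wpM2l; [rewrite divr_ge0 ?sqr_ge0 | exact: ltW].
  rewrite eta2 le_eqVlt; apply/orP; left; apply/eqP; field.
  by rewrite gt_eqF.
have trunc : \sum_i lin u (V i t) ^+ 2 * kept (V i t) <= \sum_i lin u (V i t) ^+ 2.
  by apply: ler_sum => i _; rewrite ler_piMr ?sqr_ge0 ?kept_le1.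
have := le_trans pos k2; rewrite /mu => k3.
apply: le_trans trunc; lra.
Qed.

(** There are at most [2^(12 d) <= exp (12 d)] lattice vectors, and each fails with
    probability at most [exp (- 196/16 (d + 2 L))], where [L = ln (4 / delta)]; the
    sum is at most [exp (- L) = delta / 4].  So is the probability that the trace is
    too large. *)
Lemma lower_tail (delta : R) : 0 < delta <= 1 ->
  196 * kappa * (d%:R + 2 * ln (4 / delta)) <= n%:R ->
  exists A : set T, [/\ measurable A, ((1 - delta / 2)%:E <= P A)%E &
    forall t, A t -> forall u, n%:R / 8 * normsq u <= \sum_i lin u (V i t) ^+ 2].
Proof.
move=> /andP[delta0 delta1] nlarge.
have d41 : 1 <= 4 / delta by rewrite ler_pdivlMr // mul1r; lra.
set L := ln (4 / delta) in nlarge.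
have L0 : 0 <= L by exact: ln_ge0.
have eL : expR (- L) = delta / 4.
  by rewrite expRN lnK ?posrE ?invf_div // divr_gt0.
pose low (q : grid) := [set t | (\sum_i lin (signed q) (V i t) ^+ 2 * kept (V i t) <
   n%:R * (5 / 16 * normsq (signed q)))%R].
pose tr := [set t | (n%:R * (3 * d%:R) <=
   \sum_i normsq (z ^~ (V i t)) * kept (V i t))%R].
have mlow q : measurable (low q).
  apply: measurable_ltr_set; apply: measurable_sum => i.
  apply: measurable_funM; last by apply: (measurableT_comp measurable_kept).
  by apply: measurable_funX; apply: (measurableT_comp (measurable_lin _)).
have mtr : measurable tr.
  apply: measurable_ler_set; apply: measurable_sum => i.
  apply: measurable_funM; last by apply: (measurableT_comp measurable_kept).
  exact: (measurableT_comp measurable_normsq).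
pose ball (q : grid) := (\sum_(j <- q.2) j <= 10 * d)%N.
have [mU PU] := @probability_bigsetU_le _ ball low _ mlow (fun q => lower_prob _).
set U := \big[setU/set0]_(q | _) _ in mU PU.
have nk : 196 * (d%:R + 2 * L) <= n%:R / kappa.
  by rewrite ler_pdivlMr //; lra.
have PU2 : (P U <= (delta / 4)%:E)%E.
  apply: (le_trans PU); rewrite lee_fin -eL.
  have cardB : (#|ball|%:R : R) <= expR (12 * d%:R).
    apply: (@le_trans _ _ ((2 ^ (12 * d))%N%:R)).
      rewrite ler_nat; apply: leq_trans (_ : 2 ^ (2 * d + 10 * d) <= _)%N.
        apply: leq_trans (card_l1_ball d (10 * d)).
        by apply: eq_leq; apply: eq_card => q; rewrite !inE.
      by rewrite -mulnDl.
    rewrite natrX -natrM -[X in expR X]mulr1 expRM_natl.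
    by rewrite lerXn2r ?nnegrE ?expR_ge0 ?expR1_ge2.
  apply: (@le_trans _ _ (expR (12 * d%:R) * expR (- (n%:R / (16 * kappa))))).
    by rewrite ler_wpM2r ?expR_ge0.
  rewrite -expRD ler_expR.
  have -> : n%:R / (16 * kappa) = (n%:R / kappa) / 16 by field; rewrite gt_eqF.
  have := dR; lra.
have Ptr : (P tr <= (delta / 4)%:E)%E.
  apply: (le_trans trace_prob); rewrite lee_fin -eL ler_expR.
  have -> : n%:R / (8 * kappa) = (n%:R / kappa) / 8 by field; rewrite gt_eqF.
  have := dR; lra.
exists (~` (U `|` tr)); split.
- by apply: measurableC; exact: measurableU.
- have mUtr : measurable (U `|` tr) by exact: measurableU.
  rewrite probability_setC // EFinB; apply: leeB => //.
  apply: (le_trans (measureU2 _ _ _)) => //.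
  have -> : (delta / 2)%:E = ((delta / 4)%:E + (delta / 4)%:E)%E.
    by rewrite -EFinD; congr EFin; field.
  exact: leeD.
move=> t /not_orP[tU ttr]; apply: lower_tail_pointwise.
  by rewrite ltNge; exact/negP.
move=> q qb; rewrite leNgt; apply/negP => qlow; apply: tU.
rewrite /U -bigcup_seq_cond; exists q => //=.
by rewrite mem_index_enum.
Qed.

End LowerTail.

(** * Second moment of a sum of independent centred variables *)

Section Variance.
Context (R : realType) (disp disp' : measure_display)
  (T : measurableType disp) (S : measurableType disp') (P : probability T R).
Context (n : nat) (V0 : T -> S) (V : 'I_n -> T -> S).
Hypotheses (mV0 : measurable_fun setT V0)
  (mV : forall i, measurable_fun setT (V i))
  (idV : forall i, identically_distributed P (V i) V0)
  (indepV : mutually_independent P V).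

Lemma mean_mul_indep (f g : S -> R) (a b : R) i j : i != j ->
  measurable_fun setT f -> (forall s, 0 <= f s) ->
  measurable_fun setT g -> (forall s, 0 <= g s) ->
  mean P (f \o V0) = a%:E -> mean P (g \o V0) = b%:E ->
  mean P (fun t => f (V i t) * g (V j t)) = (a * b)%:E.
Proof.
move=> ij mf f0 mg g0 fa gb.
pose F k := if k == i then f else if k == j then g else cst 1.
pose m k := if k == i then a else if k == j then b else 1 : R.
have prodE (h : 'I_n -> R) : (forall k, k != i -> k != j -> h k = 1) ->
    \prod_k h k = h i * h j.
  move=> h1; rewrite (bigD1 i) //= (bigD1 j) //= 1?eq_sym // big1 ?mulr1 //.
  by move=> k /andP[ki kj]; exact: h1.
have := @mutually_independent_integral_prod _ _ _ _ _ _ _ V F m mV indepV.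
have ji : (j == i) = false by rewrite eq_sym (negPf ij).
rewrite prodE; last by move=> k ki kj; rewrite /m (negPf ki) (negPf kj).
rewrite {2 3}/m eqxx ji eqxx => <-.
- apply: eq_integral => t _; rewrite prodE; first by rewrite /F eqxx ji eqxx.
  by move=> k ki kj; rewrite /F (negPf ki) (negPf kj).
- by move=> k; rewrite /F; case: ifP => // _; case: ifP => // _; exact: measurable_cst.
- by move=> k s; rewrite /F; case: ifP => // _; case: ifP.
move=> k; rewrite /F /m; have idk f' := @identically_distributed_integral _ _ _ _ _ _ _ _ f' (mV k) mV0 (idV k).
case: ifP => _; first by rewrite idk.
case: ifP => _; first by rewrite idk.
exact: mean_cst.
Qed.

(** With [a] and [b] the positive and negative parts of [g],
    [(\sum g_i)^2 + 2 \sum a_i b_j = \sum g_i^2 + \sum (a_i a_j + b_i b_j)],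
    where the double sums run over distinct indices.  All terms are nonnegative,
    so expectations may be taken termwise, and the three kinds of cross terms have
    the same expectation because [a] and [b] have the same mean. *)
Lemma mean_sqr_sum (g : S -> R) (G : R) :
  measurable_fun setT g ->
  P.-integrable setT (fun t => (g (V0 t))%:E) ->
  (\int[P]_t (g (V0 t))%:E = 0)%E ->
  mean P (fun t => g (V0 t) ^+ 2) = G%:E ->
  mean P (fun t => (\sum_i g (V i t)) ^+ 2) = (n%:R * G)%:E.
Proof.
move=> mg ig g0 gG.
pose a s := (`|g s| + g s) / 2; pose b s := (`|g s| - g s) / 2.
have mn : measurable_fun setT (fun s => `|g s|) by exact: measurableT_comp.
have ma : measurable_fun setT a.
  by apply: measurable_funM => //; exact: measurable_funD.
have mb : measurable_fun setT b.
  by apply: measurable_funM => //; exact: measurable_funB.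
have a0 s : 0 <= a s.
  by rewrite /a divr_ge0 //; have := ler_norm (- g s); rewrite normrN; lra.
have b0 s : 0 <= b s by rewrite /b divr_ge0 //; have := ler_norm (g s); lra.
have gab s : g s = a s - b s by rewrite /a /b; field.
have iabs : P.-integrable setT (fun t => (`|g (V0 t)|)%:E).
  by have := integrable_abse ig.
have abs_fin : (mean P (fun t => `|g (V0 t)|%R) < +oo)%E.
  by have /integrableP[_] := ig.
have mV0' (f : S -> R) : measurable_fun setT f -> measurable_fun setT (f \o V0).
  by move=> mf; exact: measurableT_comp.
have [al aE al0] : exists2 m, mean P (a \o V0) = m%:E & 0 <= m.
  have aabs : (mean P (a \o V0) <= mean P (fun t => `|g (V0 t)|%R))%E.
    apply: mean_le; [exact: mV0' | exact: (mV0' (fun s => `|g s|)) | |] => t; first exact: a0.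
    by rewrite /a /=; have := ler_norm (g (V0 t)); lra.
  have fin : mean P (fun t => `|g (V0 t)|%R) \is a fin_num.
    by rewrite ge0_fin_numE // mean_ge0.
  have [||m mE /andP[m0 _]] := @mean_fin _ _ _ P (a \o V0)
    (fine (mean P (fun t => `|g (V0 t)|%R))) (mV0' _ ma).
  - by move=> t; exact: a0.
  - by rewrite fineK.
  by exists m.
have bE : mean P (b \o V0) = al%:E.
  have : mean P (a \o V0) = (mean P (b \o V0) + \int[P]_t (g (V0 t))%:E)%E.
    rewrite /mean -integralD //.
      by apply: eq_integral => t _; rewrite -EFinD /= gab; congr EFin; ring.
    have -> : (fun t => ((b \o V0) t)%:E) =
        (fun t => (2^-1)%:E * ((`|g (V0 t)|)%:E - (g (V0 t))%:E))%E.
      by apply/funext => t; rewrite /b /= -EFinB -EFinM mulrC.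
    by apply: integrableZl => //; exact: integrableB.
  by rewrite g0 adde0 aE.
have ab2 s : g s ^+ 2 = (a s - b s) ^+ 2 by rewrite -gab.
pose aa t := \sum_i \sum_(j | j != i) a (V i t) * a (V j t).
pose bb t := \sum_i \sum_(j | j != i) b (V i t) * b (V j t).
pose ab t := \sum_i \sum_(j | j != i) a (V i t) * b (V j t).
have mVi (f : S -> R) i : measurable_fun setT f -> measurable_fun setT (fun t => f (V i t)).
  by move=> mf; exact: (measurableT_comp mf).
have mcross (f h : S -> R) : measurable_fun setT f -> measurable_fun setT h ->
    measurable_fun setT (fun t => \sum_i \sum_(j | j != i) f (V i t) * h (V j t)).
  move=> mf mh; apply: measurable_sum => i; under eq_fun do rewrite big_mkcond.
  apply: measurable_sum => j; case: (j != i) => /=; last exact: measurable_cst.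
  by apply: measurable_funM; exact: mVi.
have cross (f h : S -> R) (x y : R) : measurable_fun setT f -> (forall s, 0 <= f s) ->
    measurable_fun setT h -> (forall s, 0 <= h s) ->
    mean P (f \o V0) = x%:E -> mean P (h \o V0) = y%:E ->
    mean P (fun t => \sum_i \sum_(j | j != i) f (V i t) * h (V j t)) =
      (\sum_(i < n) \sum_(j < n | j != i) x * y)%:E.
  move=> mf f0 mh h0 fx hy; rewrite mean_sum.
  - rewrite -sumEFin; apply: eq_bigr => i _.
    under [LHS]eq_mean do rewrite big_mkcond.
    rewrite mean_sum.
    + rewrite [in RHS]big_mkcond -sumEFin; apply: eq_bigr => j _.
      case: ifPn => ji; last exact: mean_cst.
      by apply: mean_mul_indep => //; rewrite eq_sym.
    + move=> j; case: (j != i); last exact: measurable_cst.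
      by apply: measurable_funM; exact: mVi.
    + by move=> j t; case: ifP => // _; exact: mulr_ge0.
  - move=> i; under eq_fun do rewrite big_mkcond.
    apply: measurable_sum => j; case: (j != i) => /=; last exact: measurable_cst.
    by apply: measurable_funM; exact: mVi.
  - by move=> i t; apply: sumr_ge0 => j _; exact: mulr_ge0.
set K : R := \sum_(i < n) \sum_(j < n | j != i) al * al.
have aaE : mean P aa = K%:E by exact: cross.
have bbE : mean P bb = K%:E by exact: cross.
have abE : mean P ab = K%:E by exact: cross.
have aa0 t : 0 <= aa t by do 2!(apply: sumr_ge0 => ? _); exact: mulr_ge0.
have bb0 t : 0 <= bb t by do 2!(apply: sumr_ge0 => ? _); exact: mulr_ge0.
have ab0 t : 0 <= ab t by do 2!(apply: sumr_ge0 => ? _); exact: mulr_ge0.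
have maa : measurable_fun setT aa by exact: mcross.
have mbb : measurable_fun setT bb by exact: mcross.
have mab : measurable_fun setT ab by exact: mcross.
have mS : measurable_fun setT (fun t => (\sum_i g (V i t)) ^+ 2).
  by apply: measurable_funX; apply: measurable_sum => i; exact: mVi.
have msq i : measurable_fun setT (fun t => g (V i t) ^+ 2).
  by apply: measurable_funX; exact: mVi.
have diagE : mean P (fun t => \sum_i g (V i t) ^+ 2) = (n%:R * G)%:E.
  rewrite mean_sum //; last by move=> i t; exact: sqr_ge0.
  rewrite (eq_bigr (fun=> G%:E)).
    by rewrite sumEFin sumr_const card_ord mulr_natl.
  move=> i _; rewrite -gG; apply: (identically_distributed_integral (f := fun s => g s ^+ 2)) => //.
    exact: measurable_funX.
  by move=> s; exact: sqr_ge0.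
have split_sq t : (\sum_i g (V i t)) ^+ 2 + 2 * ab t =
    \sum_i g (V i t) ^+ 2 + (aa t + bb t).
  have sqE : (\sum_i g (V i t)) ^+ 2 = \sum_i g (V i t) ^+ 2 +
     \sum_i \sum_(j | j != i) g (V i t) * g (V j t).
    rewrite expr2 mulr_suml -big_split /=; apply: eq_bigr => i _.
    by rewrite mulr_sumr (bigD1 i) //= expr2.
  have swap : ab t = \sum_i \sum_(j | j != i) b (V i t) * a (V j t).
    rewrite /ab; under eq_bigr do rewrite big_mkcond.
    rewrite exchange_big /=; apply: eq_bigr => i _; rewrite [RHS]big_mkcond.
    by apply: eq_bigr => j _; rewrite eq_sym mulrC.
  rewrite sqE -addrA; congr (_ + _).
  have -> : 2 * ab t = ab t + \sum_i \sum_(j | j != i) b (V i t) * a (V j t).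
    by rewrite -swap; ring.
  rewrite /aa /bb /ab -!big_split /=; apply: eq_bigr => i _.
  rewrite -!big_split /=; apply: eq_bigr => j _.
  by rewrite (gab (V i t)) (gab (V j t)); ring.
have := @eq_mean _ _ _ P _ _ split_sq.
rewrite meanD //; first last.
- by move=> t; exact: mulr_ge0.
- by move=> t; exact: sqr_ge0.
- exact: measurable_funM.
rewrite (meanZ P mab) // abE meanD //; first last.
- by move=> t; exact: addr_ge0.
- by move=> t; apply: sumr_ge0 => i _; exact: sqr_ge0.
- exact: measurable_funD.
- exact: measurable_sum.
rewrite (meanD P maa mbb) // aaE bbE diagE -EFinM -!EFinD.
case: (mean P _) => [x||] //; rewrite -EFinD => -[H]; congr EFin; lra.
Qed.

End Variance.

(** * Positive definite forms *)

Section PositiveDefinite.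
Context (R : realType) (d : nat) (M : 'M[R]_d).
Hypothesis Msym : M^T = M.

Definition qform (w : 'cV[R]_d) : R := (w^T *m M *m w) ord0 ord0.

(** If [w^T M w = 0] then the form at [w + a M w] is [2 a |M w|^2 + O(a^2)], which
    is negative for some [a < 0] unless [M w = 0]. *)
Lemma qform_unit_gt0 : (forall w, 0 <= qform w) -> M \in unitmx ->
  forall w, w != 0 -> 0 < qform w.
Proof.
move=> M0 Mu w w0; rewrite lt_def M0 andbT; apply/negP => /eqP qw.
pose v := M *m w; pose c := qform v; pose s := (v^T *m v) ord0 ord0.
have s0 : 0 < s.
  have sE : s = \sum_j v j ord0 ^+ 2.
    by rewrite /s mxE; apply: eq_bigr => j _; rewrite mxE expr2.
  rewrite sE lt_def sumr_ge0 ?andbT; last by move=> j _; exact: sqr_ge0.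
  apply/negP => /eqP /psumr_eq0P H; move/eqP: w0; apply.
  have v0 : v = 0.
    apply/colP => j; rewrite [RHS]mxE; apply/eqP; rewrite -sqrf_eq0; apply/eqP.
    by apply: H => // k _; exact: sqr_ge0.
  by rewrite -(mulKmx Mu w) -/v v0 mulmx0.
have expand a : qform (w + a *: v) = 2 * a * s + a ^+ 2 * c.
  have e1 : (w^T *m M *m v) ord0 ord0 = s.
    by rewrite -[X in w^T *m X]Msym -trmx_mul.
  have e2 : (v^T *m M *m w) ord0 ord0 = s by rewrite -mulmxA.
  have eT : (w + a *: v)^T = w^T + a *: v^T by apply/rowP => j; rewrite !mxE.
  have -> : qform (w + a *: v) = qform w + a * (w^T *m M *m v) ord0 ord0 +
      a * (v^T *m M *m w) ord0 ord0 + a * (a * qform v).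
    rewrite /qform eT !mulmxDl !mulmxDr -!scalemxAl -!scalemxAr.
    have mxD (x y : 'M[R]_1) : (x + y) ord0 ord0 = x ord0 ord0 + y ord0 ord0 by rewrite mxE.
    have mxZ (b : R) (x : 'M[R]_1) : (b *: x) ord0 ord0 = b * x ord0 ord0 by rewrite mxE.
    by rewrite !mxD !mxZ; ring.
  by rewrite qw e1 e2 -/c; ring.
have c0 : 0 <= c by exact: M0.
have := M0 (w - (s / (c + 1)) *: v); rewrite -scaleNr expand.
have D0 : 0 < c + 1 by lra.
have -> : 2 * - (s / (c + 1)) * s + (- (s / (c + 1))) ^+ 2 * c =
    - (s ^+ 2 * (c + 2) / (c + 1) ^+ 2).
  by field; rewrite gt_eqF.
rewrite oppr_ge0 leNgt => /negP; apply.
by rewrite divr_gt0 ?exprn_gt0 // mulr_gt0 ?exprn_gt0 //; lra.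
Qed.

(** Gram-Schmidt: while there are fewer than [d] orthonormal columns, the kernel of
    [B^T M] contains a nonzero vector, which is normalized and appended. *)
Lemma qform_orthonormal : (forall w, w != 0 -> 0 < qform w) ->
  exists2 B : 'M[R]_d, B \in unitmx & B^T *m M *m B = 1%:M.
Proof.
move=> Mpos.
suff H k : (k <= d)%N -> exists B : 'M[R]_(d, k), B^T *m M *m B = 1%:M.
  have [B BM] := H d (leqnn d); exists B => //.
  by have [_ ->] := mulmx1_unit BM.
elim: k => [_|k IH kd].
  by exists (const_mx 0); apply/matrixP => -[].
have [B BM] := IH (ltnW kd); rewrite -addn1.
pose A := B^T *m M.
have /rowV0Pn[x xA x0] : kermx A^T != 0.
  rewrite -mxrank_eq0 -lt0n mxrank_ker subn_gt0.
  by apply: leq_ltn_trans kd; exact: rank_leq_col.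
have Ax : A *m x^T = 0.
  apply: trmx_inj; rewrite trmx_mul trmxK trmx0; exact/sub_kermxP.
have qx : 0 < qform x^T.
  by apply: Mpos; apply: contraNneq x0 => x0'; rewrite -[x]trmxK x0' trmx0.
pose r := (Num.sqrt (qform x^T))^-1; pose w := r *: x^T.
have Aw : A *m w = 0 by rewrite /w -scalemxAr Ax scaler0.
have wB : w^T *m M *m B = 0.
  apply: trmx_inj; rewrite trmx0 !trmx_mul trmxK Msym mulmxA; exact: Aw.
have ww : w^T *m M *m w = 1%:M.
  rewrite [LHS]mx11_scalar; congr scalar_mx.
  have wT : w^T = r *: (x^T)^T by apply/rowP => j; rewrite !mxE.
  rewrite wT /w -!scalemxAl -scalemxAr scalerA.
  have mxZ (b : R) (y : 'M[R]_1) : (b *: y) ord0 ord0 = b * y ord0 ord0 by rewrite mxE.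
  rewrite mxZ -/(qform x^T) /r -invfM.
  by rewrite -expr2 sqr_sqrtr ?ltW // mulVf // gt_eqF.
exists (row_mx B w).
rewrite tr_row_mx mul_col_mx mul_col_row BM -/A Aw wB ww.
by rewrite -scalar_mx_block.
Qed.

End PositiveDefinite.

(** * The population risk *)

Section Population.
Context (R : realType) (disp : measure_display) (T : measurableType disp)
  (P : probability T R) (d : nat) (p : R).
Context (X : T -> d.-tuple R) (Y : T -> R).
Hypotheses (p2 : 2 < p) (mX : measurable_fun setT X) (mY : measurable_fun setT Y).
Hypothesis momentY : (mean P (fun t => `|Y t| `^ p)%R < +oo)%E.
Hypothesis momentX :
  forall j, (mean P (fun t => `|tnth (X t) j| `^ p)%R < +oo)%E.
Implicit Types (w u v : 'cV[R]_d) (f g h : T -> R).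

Let p0 : 0 <= p. Proof. by apply: ltW; apply: lt_trans p2. Qed.

Lemma integrable_EFinD f g : P.-integrable setT (EFin \o f) ->
  P.-integrable setT (EFin \o g) ->
  P.-integrable setT (EFin \o (fun t => f t + g t)).
Proof. by move=> intf intg; exact: (integrableD measurableT intf intg). Qed.

Lemma integrable_EFinZ f (a : R) : P.-integrable setT (EFin \o f) ->
  P.-integrable setT (EFin \o (fun t => a * f t)).
Proof. by move=> intf; exact: (integrableZl measurableT a intf). Qed.

Lemma integrable_EFin_cst (a : R) : P.-integrable setT (EFin \o (fun=> a)).
Proof. exact: finite_measure_integrable_cst. Qed.

Lemma Rintegral_sum (I : finType) (f : I -> T -> R) :
  (forall i, P.-integrable setT (EFin \o f i)) ->
  P.-integrable setT (EFin \o (fun t => \sum_i f i t)) /\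
  \int[P]_t (\sum_i f i t) = \sum_i \int[P]_t f i t.
Proof.
move=> intf; rewrite -[index_enum I]/(index_enum I).
elim: (index_enum I) => [|i s [IH1 IH2]].
  split; first by under [X in _.-integrable _ (_ \o X)]eq_fun do rewrite big_nil;
    exact: integrable_EFin_cst.
  by under eq_Rintegral do rewrite big_nil; rewrite big_nil Rintegral_cst // mul0r.
have E : (fun t => \sum_(j <- i :: s) f j t) = (fun t => f i t + \sum_(j <- s) f j t).
  by apply/funext => t; rewrite big_cons.
rewrite E big_cons; split; first exact: integrable_EFinD.
by rewrite RintegralD // IH2.
Qed.

Lemma integrable_ge0 f : measurable_fun setT f -> (forall t, 0 <= f t) ->
  (mean P f < +oo)%E -> P.-integrable setT (EFin \o f).
Proof.
move=> mf f0 foo; apply/integrableP; split; first exact/measurable_EFinP.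
by under eq_integral => t _ do rewrite /= ger0_norm //.
Qed.

Lemma integrable_dominated f g (C : R) : measurable_fun setT f ->
  P.-integrable setT (EFin \o g) -> (forall t, `|f t| <= C * g t) ->
  P.-integrable setT (EFin \o f).
Proof.
move=> mf ig fg; apply: (@le_integrable _ _ _ _ _ measurableT _ (fun t => C%:E * (EFin \o g) t)%E).
- exact/measurable_EFinP.
- move=> t _; rewrite /= lee_fin; apply: (le_trans (fg t)); exact: ler_norm.
- exact: (integrableZl measurableT C ig).
Qed.

Lemma integrable_powRD f g : measurable_fun setT f -> measurable_fun setT g ->
  (forall t, 0 <= f t) -> (forall t, 0 <= g t) ->
  P.-integrable setT (EFin \o (fun t => f t `^ p)) ->
  P.-integrable setT (EFin \o (fun t => g t `^ p)) ->
  P.-integrable setT (EFin \o (fun t => (f t + g t) `^ p)).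
Proof.
move=> mf mg f0 g0 intf intg.
have int2 := integrable_EFinD intf intg.
apply: (@integrable_dominated _ (fun t => f t `^ p + g t `^ p) (2 `^ p)).
- apply: (measurableT_comp (f := fun x : R => x `^ p)); first exact: measurable_powR.
  exact: measurable_funD.
- exact: int2.
move=> t; rewrite ger0_norm ?powR_ge0 //.
have fp := powR_ge0 (f t) p; have gp := powR_ge0 (g t) p.
apply: (@le_trans _ _ ((2 * Num.max (f t) (g t)) `^ p)).
  apply: ge0_ler_powR; rewrite ?nnegrE ?addr_ge0 ?mulr_ge0 ?le_max ?f0 //.
  by have [h|h] := leP (f t) (g t); have := f0 t; have := g0 t; lra.
rewrite powRM ?le_max ?f0 // ler_wpM2l ?powR_ge0 //.
by have [h|h] := leP (f t) (g t); lra.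
Qed.

(** Every integrand of this section is homogeneous of degree [p] in the data, so it
    is bounded by a multiple of the [p]-th power of the envelope. *)
Definition envelope t : R := `|Y t| + \sum_j `|tnth (X t) j|.

Lemma measurable_coord j : measurable_fun setT (fun t => tnth (X t) j).
Proof. by apply: (measurableT_comp (f := fun x : d.-tuple R => tnth x j)) => //; exact: measurable_tnth. Qed.

Lemma measurable_inner w : measurable_fun setT (fun t => inner w (X t)).
Proof. by apply: measurable_sum => j; apply: measurable_funM => //; exact: measurable_coord. Qed.

Lemma measurable_residual w : measurable_fun setT (fun t => inner w (X t) - Y t).
Proof. by apply: measurable_funB => //; exact: measurable_inner. Qed.

Lemma measurable_norm_powR f q : measurable_fun setT f ->
  measurable_fun setT (fun t => `|f t| `^ q).
Proof.
move=> mf; apply: (measurableT_comp (f := fun x : R => x `^ q)).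
  exact: measurable_powR.
exact: measurableT_comp.
Qed.

Lemma measurable_slope f : measurable_fun setT f ->
  measurable_fun setT (fun t => ell_slope p (f t)).
Proof.
move=> mf; apply: measurable_funM => //; apply: measurable_funM => //.
exact: measurable_norm_powR.
Qed.

Lemma envelope_ge0 t : 0 <= envelope t.
Proof. by apply: addr_ge0 => //; apply: sumr_ge0. Qed.

Lemma integrable_envelope : P.-integrable setT (EFin \o (fun t => envelope t `^ p)).
Proof.
have mn f : measurable_fun setT f -> measurable_fun setT (fun t => `|f t|).
  by move=> mf; exact: measurableT_comp.
apply: integrable_powRD => //.
- exact: mn.
- by apply: measurable_sum => j; apply: mn; exact: measurable_coord.
- by move=> t; exact: sumr_ge0.
- by apply: integrable_ge0 => //; exact: measurable_norm_powR.
elim: (index_enum 'I_d) => [|j s IH].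
  under [X in _.-integrable _ (_ \o X)]eq_fun do rewrite big_nil.
  exact: integrable_EFin_cst.
under [X in _.-integrable _ (_ \o X)]eq_fun do rewrite big_cons.
apply: integrable_powRD => //.
- by apply: mn; exact: measurable_coord.
- by apply: measurable_sum => i; apply: mn; exact: measurable_coord.
- by move=> t; exact: sumr_ge0.
- apply: integrable_ge0 => //.
  by apply: measurable_norm_powR; exact: measurable_coord.
Qed.

Definition coef_bound w : R := 1 + \sum_j `|w j ord0|.

Lemma coef_bound_ge1 w : 1 <= coef_bound w.
Proof. by rewrite lerDl; apply: sumr_ge0. Qed.

Lemma coord_le_envelope j t : `|tnth (X t) j| <= envelope t.
Proof.
rewrite /envelope (bigD1 j) //= addrCA lerDl addr_ge0 //; exact: sumr_ge0.
Qed.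

Lemma inner_sub_le w t : `|inner w (X t)| + `|Y t| <= coef_bound w * envelope t.
Proof.
rewrite /coef_bound mulrDl mul1r addrC; apply: lerD.
  by rewrite lerDl; apply: sumr_ge0.
rewrite mulr_suml; apply: (le_trans (ler_norm_sum _ _ _)).
by apply: ler_sum => j _; rewrite normrM ler_wpM2l // coord_le_envelope.
Qed.

Lemma inner_le w t : `|inner w (X t)| <= coef_bound w * envelope t.
Proof. by apply: le_trans (inner_sub_le w t); rewrite lerDl. Qed.

Lemma residual_le w t : `|inner w (X t) - Y t| <= coef_bound w * envelope t.
Proof. exact: le_trans (ler_normB _ _) (inner_sub_le w t). Qed.

Lemma integrable_envelope_dominated f (C : R) : measurable_fun setT f ->
  (forall t, `|f t| <= C * envelope t `^ p) -> P.-integrable setT (EFin \o f).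
Proof. by move=> mf; apply: integrable_dominated => //; exact: integrable_envelope. Qed.

Lemma envelope_powM t (K a b c : R) : 0 <= K ->
  `|a| <= K * envelope t -> `|b| <= K * envelope t -> `|c| <= K * envelope t ->
  `| `|a| `^ (p - 2) * (b * c) | <= K `^ p * envelope t `^ p.
Proof.
move=> K0 ha hb hc; have e0 := envelope_ge0 t.
rewrite -powRM //.
have -> : (K * envelope t) `^ p = (K * envelope t) `^ (p - 2) * (K * envelope t) ^+ 2.
  have := norm_powRE (K * envelope t) p2; rewrite ger0_norm ?mulr_ge0 // => ->.
  by rewrite mulrC.
rewrite !normrM (ger0_norm (powR_ge0 _ _)) expr2.
apply: ler_pM; rewrite ?powR_ge0 ?mulr_ge0 //; last exact: ler_pM.
by apply: ge0_ler_powR; rewrite ?nnegrE ?mulr_ge0 // subr_ge0 ltW.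
Qed.

Lemma integrable_powM f g h (K : R) :
  measurable_fun setT f -> measurable_fun setT g -> measurable_fun setT h ->
  (forall t, `|f t| <= K * envelope t) -> (forall t, `|g t| <= K * envelope t) ->
  (forall t, `|h t| <= K * envelope t) ->
  P.-integrable setT (EFin \o (fun t => `|f t| `^ (p - 2) * (g t * h t))).
Proof.
move=> mf mg mh hf hg hh.
apply: (@integrable_envelope_dominated _ (`|K| `^ p)).
  by apply: measurable_funM; [exact: measurable_norm_powR | exact: measurable_funM].
have le_abs x t : x <= K * envelope t -> x <= `|K| * envelope t.
  by move/le_trans; apply; rewrite ler_wpM2r ?envelope_ge0 ?ler_norm.
by move=> t; apply: envelope_powM => //; exact: le_abs.
Qed.


Definition slope_term w u t : R :=
  ell_slope p (inner w (X t) - Y t) * inner u (X t).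
Definition curvature_term w u t : R :=
  `|inner w (X t) - Y t| `^ (p - 2) * inner u (X t) ^+ 2.

Let frisk w : R := fine (risk P p X Y w).

Lemma common_bound (w u v : 'cV[R]_d) : let K := coef_bound w + coef_bound u + coef_bound v in
  [/\ 0 <= K,
    forall t, `|inner w (X t) - Y t| <= K * envelope t,
    forall t, `|inner w (X t)| <= K * envelope t,
    forall t, `|inner u (X t)| <= K * envelope t &
    forall t, `|inner v (X t)| <= K * envelope t].
Proof.
have w1 := coef_bound_ge1 w; have u1 := coef_bound_ge1 u.
have v1 := coef_bound_ge1 v; set K := _ + _ + _.
have mono a t x : a <= K -> x <= a * envelope t -> x <= K * envelope t.
  by move=> aK /le_trans; apply; rewrite ler_wpM2r ?envelope_ge0.
have wK : coef_bound w <= K by rewrite /K; lra.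
have uK : coef_bound u <= K by rewrite /K; lra.
have vK : coef_bound v <= K by rewrite /K; lra.
split => [|t|t|t|t]; first by rewrite /K; lra.
- exact: mono wK (residual_le w t).
- exact: mono wK (inner_le w t).
- exact: mono uK (inner_le u t).
- exact: mono vK (inner_le v t).
Qed.

Lemma integrable_loss w :
  P.-integrable setT (EFin \o (fun t => loss p (X t) (Y t) w)).
Proof.
have [_ h1 _ _ _] := common_bound w w w.
have := integrable_powM (measurable_residual w) (measurable_residual w)
  (measurable_residual w) h1 h1 h1.
move=> /(@integrable_EFinZ _ (p * (p - 1))^-1); apply: eq_integrable => // t _ /=.
by rewrite /loss /ell (norm_powRE _ p2) expr2; congr EFin; ring.
Qed.

Lemma riskE w : risk P p X Y w = (frisk w)%:E.
Proof.
rewrite /frisk fineK // /risk unlock.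
exact: (integrable_fin_num measurableT (integrable_loss w)).
Qed.

Lemma friskE w : frisk w = \int[P]_t loss p (X t) (Y t) w.
Proof. by rewrite /frisk /risk unlock. Qed.

Lemma integrable_slope w u : P.-integrable setT (EFin \o slope_term w u).
Proof.
have [_ h1 _ h2 _] := common_bound w u u.
have := integrable_powM (measurable_residual w) (measurable_residual w)
  (measurable_inner u) h1 h1 h2.
move=> /(@integrable_EFinZ _ (p - 1)^-1); apply: eq_integrable => // t _ /=.
by rewrite /slope_term /ell_slope; congr EFin; ring.
Qed.

Lemma integrable_bilinear w u v : P.-integrable setT
  (EFin \o (fun t => `|inner w (X t) - Y t| `^ (p - 2) *
                     (inner u (X t) * inner v (X t)))).
Proof.
have [_ h1 _ h2 h3] := common_bound w u v.
exact: (integrable_powM (measurable_residual w) (measurable_inner u)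
  (measurable_inner v) h1 h2 h3).
Qed.

Lemma integrable_curvature w u : P.-integrable setT (EFin \o curvature_term w u).
Proof. exact: (integrable_bilinear w u u). Qed.

Lemma integrable_inner_powR u :
  P.-integrable setT (EFin \o (fun t => `|inner u (X t)| `^ p)).
Proof.
have [_ _ h1 _ _] := common_bound u u u.
have := integrable_powM (measurable_inner u) (measurable_inner u)
  (measurable_inner u) h1 h1 h1.
apply: eq_integrable => // t _ /=.
by rewrite (norm_powRE _ p2) expr2 mulrC.
Qed.

Definition mean_slope w u : R := \int[P]_t slope_term w u t.
Definition mean_curvature w u : R := \int[P]_t curvature_term w u t.
Definition mean_powR u : R := \int[P]_t (`|inner u (X t)| `^ p).

Lemma mean_curvature_ge0 w u : 0 <= mean_curvature w u.
Proof. by apply: Rintegral_ge0 => t _; rewrite mulr_ge0 ?powR_ge0 ?sqr_ge0. Qed.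

Lemma mean_powR_ge0 u : 0 <= mean_powR u.
Proof. by apply: Rintegral_ge0 => t _; exact: powR_ge0. Qed.

Lemma lossD w u t : loss p (X t) (Y t) (w + u) =
  ell p ((inner w (X t) - Y t) + inner u (X t)).
Proof. by rewrite /loss innerD; congr ell; ring. Qed.

Let breg w u t := loss p (X t) (Y t) (w + u) - loss p (X t) (Y t) w - slope_term w u t.

Let integrable_breg w u : P.-integrable setT (EFin \o breg w u).
Proof.
have i1 := integrable_EFinD (integrable_loss (w + u))
   (integrable_EFinZ (-1) (integrable_loss w)).
have := integrable_EFinD i1 (integrable_EFinZ (-1) (integrable_slope w u)).
by apply: eq_integrable => // t _ /=; rewrite !mulN1r.
Qed.

Let integral_breg w u : \int[P]_t breg w u t = frisk (w + u) - frisk w - mean_slope w u.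
Proof.
have i1 := integrable_loss (w + u); have i2 := integrable_loss w.
have i3 := integrable_slope w u.
rewrite !friskE /mean_slope -!RintegralB //.
have := integrable_EFinD i1 (integrable_EFinZ (-1) i2).
by apply: eq_integrable => // t _ /=; rewrite !mulN1r.
Qed.

Lemma risk_bregman_ge w u :
  mean_curvature w u / (2 * (p - 1)) <= frisk (w + u) - frisk w - mean_slope w u.
Proof.
rewrite -integral_breg mulrC -RintegralZl //; last exact: integrable_curvature.
apply: le_Rintegral => //.
- exact: (integrable_EFinZ _ (integrable_curvature w u)).
move=> t _; rewrite /breg lossD mulrC.
exact: ell_bregman_ge.
Qed.

Lemma risk_bregman_le w u :
  frisk (w + u) - frisk w - mean_slope w u <=
  4 * mean_curvature w u + p `^ p * mean_powR u.
Proof.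
have i1 := integrable_curvature w u; have i2 := integrable_inner_powR u.
rewrite -integral_breg -!RintegralZl // -RintegralD //; first last.
- exact: integrable_EFinZ.
- exact: integrable_EFinZ.
apply: le_Rintegral => //.
- by apply: integrable_EFinD; exact: integrable_EFinZ.
move=> t _; rewrite /breg lossD; exact: ell_bregman_le.
Qed.

Lemma mean_slopeZ w u (a : R) : mean_slope w (a *: u) = a * mean_slope w u.
Proof.
rewrite /mean_slope -RintegralZl //; last exact: integrable_slope.
by apply: eq_Rintegral => t _; rewrite /slope_term innerZ; ring.
Qed.

Lemma mean_curvatureZ w u (a : R) :
  mean_curvature w (a *: u) = a ^+ 2 * mean_curvature w u.
Proof.
rewrite /mean_curvature -RintegralZl //; last exact: integrable_curvature.
by apply: eq_Rintegral => t _; rewrite /curvature_term innerZ; ring.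
Qed.

Lemma mean_powRZ u (a : R) : mean_powR (a *: u) = `|a| `^ p * mean_powR u.
Proof.
rewrite /mean_powR -RintegralZl //; last exact: integrable_inner_powR.
by apply: eq_Rintegral => t _; rewrite innerZ normrM powRM.
Qed.

Lemma risk_expansion w u (a : R) : `|a| <= 1 ->
  0 <= frisk (w + a *: u) - frisk w - a * mean_slope w u <=
  (4 * mean_curvature w u + p `^ p * mean_powR u) * a ^+ 2.
Proof.
move=> a1; rewrite -mean_slopeZ; apply/andP; split.
  apply: le_trans (risk_bregman_ge _ _); rewrite divr_ge0 ?mean_curvature_ge0 //.
  by have := p2; lra.
apply: (le_trans (risk_bregman_le _ _)).
rewrite mean_curvatureZ mean_powRZ [leRHS]mulrDl.
apply: lerD; first by rewrite [X in 4 * X]mulrC mulrA.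
rewrite -[leRHS]mulrA ler_wpM2l ?powR_ge0 // mulrC ler_wpM2l ?mean_powR_ge0 //.
rewrite (norm_powRE _ p2) ler_piMr ?sqr_ge0 //.
apply: (@le_trans _ _ (1 `^ (p - 2))); last by rewrite powR1.
by apply: ge0_ler_powR; rewrite ?nnegrE // subr_ge0 ltW.
Qed.

Lemma is_derive_risk w u : is_derive w u frisk (mean_slope w u).
Proof.
apply: (@is_derive_quadratic _ _ _ _ _ _
  (4 * mean_curvature w u + p `^ p * mean_powR u)) => a a1.
have /andP[h1 h2] := risk_expansion w u a1.
by rewrite [a *: u + w]addrC ger0_norm.
Qed.

(** The expansion at [ws + a u], with [a] a small negative multiple of the slope,
    would otherwise give a smaller risk. *)
Lemma minimizer_mean_slope0 ws u :
  (forall w, (risk P p X Y ws <= risk P p X Y w)%E) -> mean_slope ws u = 0.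
Proof.
move=> hws; apply/eqP; apply: contraT => L0.
have {}hws w : frisk ws <= frisk w by have := hws w; rewrite !riskE lee_fin.
set L := mean_slope ws u in L0 *.
set C := 4 * mean_curvature ws u + p `^ p * mean_powR u.
have C0 : 0 <= C.
  by rewrite addr_ge0 // mulr_ge0 ?powR_ge0 ?mean_curvature_ge0 ?mean_powR_ge0.
have Ln := normr_ge0 L.
(* small enough for both |s L| <= 1 and C s < 1 *)
pose s := (C + `|L| + 1)^-1.
have D0 : 0 < C + `|L| + 1 by lra.
have s0 : 0 < s by rewrite invr_gt0.
have s1 : `|- (s * L)| <= 1.
  by rewrite normrN normrM gtr0_norm // /s mulrC ler_pdivrMr // mul1r; lra.
have /andP[_] := risk_expansion ws u s1.
have := hws (ws + - (s * L) *: u); rewrite -/C -/L => h1 h2.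
have L2 : 0 < L ^+ 2 by rewrite exprn_even_gt0.
have sD : s * (C + `|L| + 1) = 1 by rewrite /s mulVf // gt_eqF.
have h3 : 0 <= s * L ^+ 2 * (C * s - 1) by nra.
have h4 : C * s < 1 by nra.
have h5 : 0 < s * L ^+ 2 by exact: mulr_gt0.
nra.
Qed.

(** The first derivative of the risk is [mean_slope]; the second one is taken under
    the integral, on the segment [|a| < 1] where the derivative of the integrand is
    dominated by the envelope. *)
Lemma HpE ws : Hp P p X Y ws =
  \matrix_(i, j) \int[P]_t (`|inner ws (X t) - Y t| `^ (p - 2) *
     (tnth (X t) i * tnth (X t) j)).
Proof.
apply/matrixP => i j; rewrite !mxE.
have -> : (fun v => 'D_(delta_mx j ord0) (fun w => fine (risk P p X Y w)) v) =
    (fun v => mean_slope v (delta_mx j ord0)).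
  by apply/funext => v; have [_ ->] := is_derive_risk v (delta_mx j ord0).
pose ei : 'cV[R]_d := delta_mx i ord0; pose ej : 'cV[R]_d := delta_mx j ord0.
pose F (a : R) t := slope_term (a *: ei + ws) ej t.
have dF (a : R) t : is_derive a 1 (F ^~ t)
    (`|inner (a *: ei + ws) (X t) - Y t| `^ (p - 2) * (tnth (X t) i * tnth (X t) j)).
  have E : F ^~ t = (fun a => tnth (X t) j *
      ell_slope p (tnth (X t) i * a + (inner ws (X t) - Y t))).
    apply/funext => b; rewrite /F /slope_term innerD innerZ !inner_delta mulrC.
    by congr (_ * ell_slope p _); ring.
  have E2 : inner (a *: ei + ws) (X t) - Y t =
      tnth (X t) i * a + (inner ws (X t) - Y t).
    by rewrite innerD innerZ inner_delta; ring.
  rewrite E E2.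
  have := is_deriveZ (tnth (X t) j) (is_derive_affine_comp (is_derive_ell_slope
    (tnth (X t) i * a + (inner ws (X t) - Y t)) p2)).
  by rewrite /GRing.scale /= mulrCA mulrA mulrC mulrA [_ * tnth (X t) i]mulrC.
pose K := coef_bound ws + 1.
have K1 : 1 <= K by have := coef_bound_ge1 ws; rewrite /K; lra.
have Ki k t : `|tnth (X t) k| <= K * envelope t.
  apply: (le_trans (coord_le_envelope k t)).
  by rewrite ler_peMl // envelope_ge0.
have Kr a t : `]-1, 1[%classic a -> `|inner (a *: ei + ws) (X t) - Y t| <= K * envelope t.
  rewrite /= in_itv /= => /andP[a1 a2].
  rewrite innerD innerZ inner_delta -addrA addrC /K mulrDl mul1r.
  apply: (le_trans (ler_normD _ _)); apply: lerD; first exact: residual_le.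
  rewrite normrM; apply: le_trans (coord_le_envelope i t).
  by rewrite ler_piMl // ler_norml !ltW.
have d1F a t : partial1of2 F a t = `|inner (a *: ei + ws) (X t) - Y t| `^ (p - 2) *
    (tnth (X t) i * tnth (X t) j).
  by rewrite partial1of2E; have [_ ->] := dF a t.
have I0 : `]-1, 1[%classic (0 : R) by rewrite /= in_itv /= ltrN10 ltr01.
have iF (a : R) : `]-1, 1[%classic a -> P.-integrable setT (EFin \o F a).
  by move=> _; exact: integrable_slope.
have derF (a : R) t : `]-1, 1[%classic a -> setT t -> derivable (F ^~ t) a 1.
  by move=> _ _; have [] := dF a t.
have G0 t : 0 <= K `^ p * envelope t `^ p by rewrite mulr_ge0 ?powR_ge0.
have iG : P.-integrable setT (EFin \o (fun t => K `^ p * envelope t `^ p)).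
  exact: integrable_EFinZ integrable_envelope.
have Gub (a : R) t : `]-1, 1[%classic a -> setT t ->
    `|partial1of2 F a t| <= K `^ p * envelope t `^ p.
  move=> Ia _; rewrite d1F; apply: envelope_powM => //; first by lra.
  exact: Kr.
have D1 := derivable_under_integral measurableT I0 iF derF G0 iG Gub.
have D2 := differentiation_under_integral measurableT I0 iF derF G0 iG Gub.
rewrite derive1E in D2.
have D : is_derive (0 : R) 1 (fun a : R => mean_slope (a *: ei + ws) ej)
    (\int[P]_t partial1of2 F 0 t) by exact: (DeriveDef D1 D2).
have [_ ->] := @is_derive_line _ _ (fun w => mean_slope w ej) ws ei _ D.
by apply: eq_Rintegral => t _; rewrite d1F scale0r add0r.
Qed.

Lemma mean_curvatureE ws w : mean_curvature ws w = qform (Hp P p X Y ws) w.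
Proof.
have ib i j : P.-integrable setT (EFin \o (fun t =>
    `|inner ws (X t) - Y t| `^ (p - 2) * (tnth (X t) i * tnth (X t) j))).
  have := integrable_bilinear ws (delta_mx i ord0) (delta_mx j ord0).
  by apply: eq_integrable => // t _ /=; rewrite !inner_delta.
have inner_sum i t : \sum_j w i ord0 * (w j ord0 * (`|inner ws (X t) - Y t| `^ (p - 2) *
     (tnth (X t) i * tnth (X t) j))) =
    w i ord0 * tnth (X t) i * (`|inner ws (X t) - Y t| `^ (p - 2) * inner w (X t)).
  by rewrite /inner !mulr_sumr; apply: eq_bigr => j _; rewrite /inner; ring.
rewrite HpE /qform mxE.
transitivity (\sum_i \int[P]_t (\sum_j w i ord0 * (w j ord0 *
   (`|inner ws (X t) - Y t| `^ (p - 2) * (tnth (X t) i * tnth (X t) j))))).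
  have int_i i : P.-integrable setT (EFin \o (fun t => \sum_j w i ord0 * (w j ord0 *
     (`|inner ws (X t) - Y t| `^ (p - 2) * (tnth (X t) i * tnth (X t) j))))).
    by apply: (Rintegral_sum _).1 => j; do 2!apply: integrable_EFinZ.
  rewrite -(Rintegral_sum int_i).2; apply: eq_Rintegral => t _.
  under eq_bigr do rewrite inner_sum.
  by rewrite -mulr_suml -/(inner w (X t)) /curvature_term; ring.
have int_ij i j : P.-integrable setT (EFin \o (fun t => w i ord0 * (w j ord0 *
     (`|inner ws (X t) - Y t| `^ (p - 2) * (tnth (X t) i * tnth (X t) j))))).
  by do 2!apply: integrable_EFinZ.
transitivity (\sum_i \sum_j w i ord0 * (w j ord0 * \int[P]_t
   (`|inner ws (X t) - Y t| `^ (p - 2) * (tnth (X t) i * tnth (X t) j)))).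
  apply: eq_bigr => i _; rewrite (Rintegral_sum (int_ij i)).2.
  apply: eq_bigr => j _; rewrite RintegralZl //; last exact: integrable_EFinZ.
  by rewrite RintegralZl.
rewrite exchange_big /=; apply: eq_bigr => j _; rewrite mxE mulr_suml.
by apply: eq_bigr => i _; rewrite !mxE; ring.
Qed.

Lemma Hp_sym ws : (Hp P p X Y ws)^T = Hp P p X Y ws.
Proof.
apply/matrixP => i j; rewrite HpE !mxE.
by apply: eq_Rintegral => t _; congr (_ * _); rewrite mulrC.
Qed.

End Population.

(** * Whitened coordinates *)

Section Whitening.
Context (R : realType) (disp : measure_display) (T : measurableType disp)
  (P : probability T R) (d n : nat) (p : R).
Context (X : T -> d.-tuple R) (Y : T -> R)
  (Xs : 'I_n -> T -> d.-tuple R) (Ys : 'I_n -> T -> R) (ws : 'cV[R]_d).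
Hypotheses (p2 : 2 < p) (mX : measurable_fun setT X) (mY : measurable_fun setT Y)
  (mXs : forall i, measurable_fun setT (Xs i))
  (mYs : forall i, measurable_fun setT (Ys i)).
Hypothesis momentY : (mean P (fun t => `|Y t| `^ p)%R < +oo)%E.
Hypothesis momentX :
  forall j, (mean P (fun t => `|tnth (X t) j| `^ p)%R < +oo)%E.
Hypotheses
  (idV : forall i, identically_distributed P (fun t => (Xs i t, Ys i t))
                     (fun t => (X t, Y t)))
  (indepV : mutually_independent P (fun i t => (Xs i t, Ys i t))).
Hypothesis hws : forall w, (risk P p X Y ws <= risk P p X Y w)%E.
Variable B : 'M[R]_d.
Hypothesis BHB : B^T *m Hp P p X Y ws *m B = 1%:M.

Local Notation H := (Hp P p X Y ws).
Let S : measurableType _ := (d.-tuple R * R)%type.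
Let V0 t : S := (X t, Y t).
Let V i t : S := (Xs i t, Ys i t).

Let mV0 : measurable_fun setT V0. Proof. exact: measurable_fun_pair. Qed.
Let mV i : measurable_fun setT (V i). Proof. exact: measurable_fun_pair. Qed.

Definition residual (v : S) : R := inner ws v.1 - v.2.
(** The columns of [B] are orthonormal for the Hessian of the risk.  In this basis
    [white] are the coordinates of the observation whose second moment is the
    Hessian, and [score] those of the gradient of the loss. *)
Definition white (k : 'I_d) (v : S) : R :=
  Num.sqrt (`|residual v| `^ (p - 2)) * inner (col k B) v.1.
Definition score (k : 'I_d) (v : S) : R :=
  ell_slope p (residual v) * inner (col k B) v.1.

Let mfst : measurable_fun setT (fst : S -> d.-tuple R).
Proof. exact: measurable_fst. Qed.
Let msnd : measurable_fun setT (snd : S -> R).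
Proof. exact: measurable_snd. Qed.

Lemma measurable_sample_residual : measurable_fun setT residual.
Proof. exact: (measurable_residual (X := fst) (Y := snd)). Qed.

Lemma measurable_white k : measurable_fun setT (white k).
Proof.
apply: measurable_funM; last exact: (measurable_inner (X := fst)).
apply: (measurableT_comp (f := @Num.sqrt R)); first exact: (continuous_measurable_fun (@sqrt_continuous R)).
exact: (measurable_norm_powR _ measurable_sample_residual).
Qed.

Lemma measurable_score k : measurable_fun setT (score k).
Proof.
apply: measurable_funM; last exact: (measurable_inner (X := fst)).
exact: (measurable_slope _ measurable_sample_residual).
Qed.

Lemma inner_mulmx_col (a : 'cV[R]_d) x :
  inner (B *m a) x = \sum_k a k ord0 * inner (col k B) x.
Proof.
rewrite /inner; under eq_bigr do rewrite mxE mulr_suml.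
rewrite exchange_big /=; apply: eq_bigr => k _; rewrite mulr_sumr.
by apply: eq_bigr => j _; rewrite mxE mulrA [B j k * _]mulrC.
Qed.

Lemma lin_white (u : 'I_d -> R) v :
  lin white u v = Num.sqrt (`|residual v| `^ (p - 2)) *
                  inner (B *m \col_k u k) v.1.
Proof.
rewrite inner_mulmx_col mulr_sumr; apply: eq_bigr => k _.
by rewrite mxE /white mulrCA.
Qed.

Lemma qform_mulmx (a : 'cV[R]_d) : qform H (B *m a) = \sum_k a k ord0 ^+ 2.
Proof.
rewrite /qform trmx_mul.
have -> : a^T *m B^T *m H *m (B *m a) = a^T *m (B^T *m H *m B) *m a.
  by rewrite !mulmxA.
rewrite BHB mulmx1 mxE; apply: eq_bigr => k _; by rewrite mxE expr2.
Qed.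

Lemma white_second u : mean P (fun t => lin white u (V0 t) ^+ 2) = (normsq u)%:E.
Proof.
pose a : 'cV[R]_d := \col_k u k.
have -> : normsq u = mean_curvature P p X Y ws (B *m a).
  rewrite mean_curvatureE // qform_mulmx; apply: eq_bigr => k _.
  by rewrite mxE.
rewrite /mean_curvature /Rintegral fineK; last first.
  exact: (integrable_fin_num measurableT (integrable_curvature p2 mX mY momentY momentX _ _)).
by apply: eq_integral => t _; rewrite lin_white exprMn sqr_sqrtr // powR_ge0.
Qed.

Lemma invmx_H : invmx H = B *m B^T.
Proof.
have BB : B *m B^T *m H = 1%:M.
  by rewrite -mulmxA; apply: mulmx1C.
have [_ Hu] := mulmx1_unit BB.
by rewrite -[RHS]mulmx1 -(mulmxV Hu) mulmxA BB mul1mx.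
Qed.

Lemma mxnorm_gradient v :
  mxnorm (invmx H) (gradient (loss p v.1 v.2) ws) ^+ 2 = \sum_k score k v ^+ 2.
Proof.
set gr := gradient _ _.
have E : (gr^T *m invmx H *m gr) ord0 ord0 = \sum_k score k v ^+ 2.
  have -> : gr^T *m invmx H *m gr = (B^T *m gr)^T *m (B^T *m gr).
    by rewrite invmx_H trmx_mul trmxK !mulmxA.
  rewrite mxE; apply: eq_bigr => k _; rewrite mxE -expr2; congr (_ ^+ 2).
  rewrite mxE /score /inner mulr_sumr; apply: eq_bigr => j _.
  by rewrite /gr gradient_lossE // !mxE /residual; ring.
rewrite /mxnorm E sqr_sqrtr //; apply: sumr_ge0 => k _; exact: sqr_ge0.
Qed.

Lemma grad_noiseE :
  grad_noise P p X Y ws = mean P (fun t => \sum_k score k (V0 t) ^+ 2).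
Proof.
rewrite /grad_noise unlock; apply: eq_integral => t _.
by rewrite (mxnorm_gradient (V0 t)).
Qed.

Lemma score_noise (delta G : R) : (0 < n)%N -> 0 < delta ->
  grad_noise P p X Y ws = G%:E ->
  exists A : set T, [/\ measurable A, ((1 - delta / 2)%:E <= P A)%E &
    forall t, A t -> \sum_k (\sum_i score k (V i t)) ^+ 2 <= 2 * n%:R * G / delta].
Proof.
move=> n0 delta0; rewrite grad_noiseE => GE.
have nR : 0 < n%:R :> R by rewrite ltr0n.
pose F t := \sum_k (\sum_i score k (V i t)) ^+ 2.
have F0 t : 0 <= F t by apply: sumr_ge0 => k _; exact: sqr_ge0.
have mSi k : measurable_fun setT (fun t => \sum_i score k (V i t)).
  by apply: measurable_sum => i; exact: (measurableT_comp (measurable_score k)).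
have mF : measurable_fun setT F.
  by apply: measurable_sum => k; exact: measurable_funX.
have ms2 k : measurable_fun setT (fun t => score k (V0 t) ^+ 2).
  by apply: measurable_funX; exact: (measurableT_comp (measurable_score k)).
have G0 : 0 <= G.
  by rewrite -lee_fin -GE mean_ge0 // => t; apply: sumr_ge0 => k _; exact: sqr_ge0.
have mk_le k : (mean P (fun t => score k (V0 t) ^+ 2)%R <= G%:E)%E.
  rewrite -GE; apply: mean_le => //; first exact: measurable_sum.
    by move=> t; exact: sqr_ge0.
  move=> t; rewrite (bigD1 k) //= lerDl; apply: sumr_ge0 => j _; exact: sqr_ge0.
have mk_fin k := mean_fin (ms2 k) (fun t => sqr_ge0 _) (mk_le k).
pose Gk k := fine (mean P (fun t => score k (V0 t) ^+ 2)).
have GkE k : mean P (fun t => score k (V0 t) ^+ 2) = (Gk k)%:E.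
  by have [m mE _] := mk_fin k; rewrite /Gk mE.
have FE : mean P F = (n%:R * G)%:E.
  rewrite mean_sum //; first last.
  - by move=> k t; exact: sqr_ge0.
  - by move=> k; exact: measurable_funX.
  have -> : G = \sum_k Gk k.
    apply: EFin_inj; rewrite -GE mean_sum //; last by move=> k t; exact: sqr_ge0.
    by rewrite -sumEFin; apply: eq_bigr => k _; rewrite GkE.
  rewrite mulr_sumr -sumEFin; apply: eq_bigr => k _.
  have iS := @integrable_slope _ _ _ _ _ _ _ _ p2 mX mY momentY momentX ws (col k B).
  apply: (mean_sqr_sum mV0 mV idV indepV (measurable_score k) _ _ (GkE k)) => //.
  have := minimizer_mean_slope0 p2 mX mY momentY momentX (col k B) hws.
  rewrite /mean_slope /Rintegral => s0.
  have fin := integrable_fin_num measurableT iS.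
  by rewrite -[LHS](fineK fin) s0.
(* without noise the threshold of Markov's inequality would be 0 *)
have [G1|G1] := leP G 0.
  have {G1}G0' : G = 0 by apply/eqP; rewrite eq_le G1.
  have : ae_eq P setT (EFin \o F) (cst 0%E).
    apply/(ae_eq_integral_abs _ measurableT); first exact/measurable_EFinP.
    rewrite -[RHS](_ : (n%:R * G)%:E = 0%E); last by rewrite G0' mulr0.
    rewrite -FE; apply: eq_integral => t _.
    by rewrite /= ger0_norm.
  move=> [N [mN PN NF]]; exists (~` N); split.
  - exact: measurableC.
  - by rewrite probability_setC // PN sube0 lee_fin gerBl divr_ge0 // ltW.
  - move=> t Nt; rewrite G0' mulr0 mul0r.
    rewrite -/(F t) leNgt; apply/negP => Ft; apply: Nt; apply: NF => /= /(_ I) [FF].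
    by move: Ft; rewrite FF ltxx.
pose a := 2 * n%:R * G / delta.
have a0 : 0 < a by rewrite /a divr_gt0 // !mulr_gt0.
have mA : measurable [set t | (a <= F t)%R] by exact: measurable_ler_set.
exists (~` [set t | (a <= F t)%R]); split.
- exact: measurableC.
- rewrite probability_setC // EFinB; apply: leeB => //.
  have -> : delta / 2 = (n%:R * G) / a.
    by rewrite /a; field; rewrite !gt_eqF.
  by apply: markov_ge0 => //; rewrite FE.
- by move=> t /negP; rewrite -ltNge => /ltW.
Qed.

(** By [ell_bregman_ge] and the optimality of [w], the empirical curvature at
    [w - ws] is at most [2 (p-1)] times minus the pairing of [w - ws] with the
    empirical gradient at [ws]. *)
Lemma empirical_minimizer_le t w : (0 < n)%N ->
  (forall u, n%:R / 8 * normsq u <= \sum_i lin white u (V i t) ^+ 2) ->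
  emp_risk p (Xs ^~ t) (Ys ^~ t) w <= emp_risk p (Xs ^~ t) (Ys ^~ t) ws ->
  qform H (w - ws) * n%:R ^+ 2 <=
  (16 * (p - 1)) ^+ 2 * \sum_k (\sum_i score k (V i t)) ^+ 2.
Proof.
move=> n0 low; have nR : 0 < n%:R :> R by rewrite ltr0n.
rewrite /emp_risk ler_pM2l ?invr_gt0 // => emp.
have p1 : 0 < p - 1 by have := p2; lra.
have [Bu _] := mulmx1_unit (mulmx1C BHB : B *m (B^T *m H) = 1%:M).
pose a := invmx B *m (w - ws).
have aE : w - ws = B *m a by rewrite /a mulKVmx.
rewrite aE qform_mulmx; set D := \sum_k _.
pose u k := a k ord0.
have uE : (\col_k u k) = a by apply/colP => k; rewrite mxE.
have lin_sq i : lin white u (V i t) ^+ 2 =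
    `|residual (V i t)| `^ (p - 2) * inner (w - ws) (Xs i t) ^+ 2.
  by rewrite lin_white exprMn sqr_sqrtr ?powR_ge0 // uE -aE.
have breg i : lin white u (V i t) ^+ 2 / (2 * (p - 1)) <=
    loss p (Xs i t) (Ys i t) w - loss p (Xs i t) (Ys i t) ws -
    ell_slope p (residual (V i t)) * inner (w - ws) (Xs i t).
  rewrite lin_sq; have := ell_bregman_ge (residual (V i t)) (inner (w - ws) (Xs i t)) p2.
  have -> // : residual (V i t) + inner (w - ws) (Xs i t) = inner w (Xs i t) - Ys i t.
  have -> : inner w (Xs i t) = inner (w - ws) (Xs i t) + inner ws (Xs i t).
    by rewrite -innerD subrK.
  by rewrite /residual /=; ring.
have sum_breg : (\sum_i lin white u (V i t) ^+ 2) / (2 * (p - 1)) <=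
    - \sum_k u k * \sum_i score k (V i t).
  rewrite mulr_suml; apply: (le_trans (ler_sum _ (fun i _ => breg i))).
  rewrite !sumrB; have -> : \sum_i ell_slope p (residual (V i t)) * inner (w - ws) (Xs i t)
      = \sum_k u k * \sum_i score k (V i t).
    under [RHS]eq_bigr do rewrite mulr_sumr.
    rewrite exchange_big /=; apply: eq_bigr => i _.
    rewrite aE inner_mulmx_col mulr_sumr; apply: eq_bigr => k _.
    by rewrite /score /u mulrCA.
  by rewrite lerBlDr addNr subr_le0.
(* e is the coefficient in the curvature bound; with this weight, the inequality
   between arithmetic and geometric means uses up half of that bound *)
pose e := n%:R / (16 * (p - 1)).
have e0 : 0 < e by rewrite divr_gt0 // mulr_gt0.
have amgm : - (\sum_k u k * \sum_i score k (V i t)) <=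
    e / 2 * D + (2 * e)^-1 * \sum_k (\sum_i score k (V i t)) ^+ 2.
  rewrite -sumrN /D !mulr_sumr -big_split /=; apply: ler_sum => k _.
  set s := \sum_i _; rewrite -/(u k).
  have -> : e / 2 * u k ^+ 2 + (2 * e)^-1 * s ^+ 2 =
      (2 * e)^-1 * (e * u k + s) ^+ 2 - u k * s.
    by field; rewrite gt_eqF.
  by rewrite lerDr mulr_ge0 ?sqr_ge0 // invr_ge0 mulr_ge0 // ltW.
have lowu := low u.
have eD : e * D <= e / 2 * D + (2 * e)^-1 * \sum_k (\sum_i score k (V i t)) ^+ 2.
  apply: le_trans amgm; apply: le_trans sum_breg.
  rewrite ler_pdivlMr ?mulr_gt0 //; apply: le_trans lowu.
  rewrite /normsq -/D le_eqVlt; apply/orP; left; apply/eqP.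
  by rewrite /e; field; rewrite gt_eqF.
set Q := \sum_k (\sum_i _) ^+ 2 in eD *.
have : 2 * e * (e * D - e / 2 * D) <= 2 * e * ((2 * e)^-1 * Q).
  by apply: ler_wpM2l; lra.
rewrite mulrA mulfV ?mul1r; last by rewrite gt_eqF // mulr_gt0.
have -> : 2 * e * (e * D - e / 2 * D) = (D * n%:R ^+ 2) / (16 * (p - 1)) ^+ 2.
  by rewrite /e; field; rewrite gt_eqF.
have c0 : 0 < (16 * (p - 1)) ^+ 2 by rewrite exprn_gt0 // mulr_gt0.
by rewrite ler_pdivrMr // [Q * _]mulrC.
Qed.

End Whitening.

(** * Ratios of norms *)

Section Ratios.
Context (R : realType) (disp : measure_display) (T : measurableType disp)
  (P : probability T R) (d : nat) (p : R).
Context (X : T -> d.-tuple R) (Y : T -> R) (ws : 'cV[R]_d).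
Hypotheses (p2 : 2 < p) (mX : measurable_fun setT X) (mY : measurable_fun setT Y).
Hypothesis momentY : (mean P (fun t => `|Y t| `^ p)%R < +oo)%E.
Hypothesis momentX :
  forall j, (mean P (fun t => `|tnth (X t) j| `^ p)%R < +oo)%E.

Local Notation Q := (mean_curvature P p X Y ws).

Lemma normLqp2E w : normLqp P p X Y ws 2 w = (Num.sqrt (Q w))%:E.
Proof.
have Q0 : 0 <= Q w by exact: mean_curvature_ge0.
rewrite -(powR12_sqrt Q0) -poweR_EFin /normLqp unlock; congr (_ `^ _)%E.
rewrite /mean_curvature /Rintegral fineK; last first.
  exact: (integrable_fin_num measurableT (integrable_curvature p2 mX mY momentY momentX _ _)).
apply: eq_integral => t _; rewrite mxnorm_hessian_loss // /= powR_mulrn //.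
by rewrite real_normK ?num_real // exprMn sqr_sqrtr ?powR_ge0 // real_normK ?num_real.
Qed.

Lemma normLqp4E w : (normLqp P p X Y ws 4 w `^ 4)%E =
  mean P (fun t => curvature_term p X Y ws w t ^+ 2).
Proof.
rewrite /normLqp poweR_Lnorm ?pnatr_eq0 //; apply: eq_integral => t _.
rewrite mxnorm_hessian_loss // /= powR_mulrn // /curvature_term.
rewrite normrM normr_id (ger0_norm (sqrtr_ge0 _)) (_ : 4 = 2 * 2)%N // exprM.
congr ((_ ^+ 2)%:E); rewrite exprMn sqr_sqrtr ?powR_ge0 //.
by rewrite real_normK ?num_real.
Qed.

Lemma normLpE w : (normLp P p X w `^ p)%E = (mean_powR P p X w)%:E.
Proof.
rewrite /normLp poweR_Lnorm; last by rewrite gt_eqF // (lt_trans _ p2).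
rewrite /mean_powR /Rintegral fineK //.
exact: (integrable_fin_num measurableT (integrable_inner_powR p2 mX mY momentY momentX _)).
Qed.

Lemma ratio_poweR_le (N : \bar R) (c s q : R) : 0 < q -> (0 <= N)%E -> 0 < s ->
  (N / s%:E <= c%:E)%E -> (N `^ q <= ((c * s) `^ q)%:E)%E.
Proof.
move=> q0 N0 s0; rewrite inver gt_eqF // lee_pdivrMr // -EFinM.
case: N N0 => [x||] //; rewrite !lee_fin => x0 xle.
by apply: ge0_ler_powR; rewrite ?nnegrE //; [exact: ltW | exact: le_trans x0 xle].
Qed.

Lemma ratio_ge0 (N : \bar R) s : (0 <= N)%E -> 0 < s -> (0 <= N / s%:E)%E.
Proof. by move=> N0 s0; rewrite mule_ge0 // inve_ge0 lee_fin ltW. Qed.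

Hypothesis Qpos : forall w, w != 0 -> 0 < Q w.

(** An infinite supremum would make the assumed bound on [sigma2] fail, and so would
    the empty supremum [-oo] of dimension [0], whose fourth power is [+oo]. *)
Lemma sigma2_finite (L c : R) : 0 < L ->
  (196%:E * sigma2 P p X Y ws * L%:E <= c%:E)%E ->
  exists kappa, [/\ (0 < d)%N, 196 * kappa * L <= c &
    forall w, w != 0 ->
      (mean P (fun t => curvature_term p X Y ws w t ^+ 2)%R <=
        (kappa * Q w ^+ 2)%:E)%E].
Proof.
move=> L0; rewrite /sigma2; set A := [set _ | _ in _].
have ubA w : w != 0 -> (normLqp P p X Y ws 4 w / normLqp P p X Y ws 2 w
    <= ereal_sup A)%E.
  by move=> w0; apply: ereal_sup_ubound; exists w.
have infinite : (196%:E * +oo * L%:E <= c%:E)%E -> False.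
  by rewrite gt0_muley ?lte_fin // gt0_mulye ?lte_fin // leye_eq.
case E : (ereal_sup A) ubA => [r||] ubA hc; last 2 first.
- by exfalso; apply: infinite.
- by exfalso; apply: infinite.
have d0 : (0 < d)%N.
  rewrite lt0n; apply/negP => /eqP d0; move: E; rewrite (_ : A = set0) ?ereal_sup0 //.
  apply/seteqP; split => // x [w w0 _]; move/eqP: w0; apply.
  by apply/colP => j; exfalso; case: j => m; rewrite d0 ltn0.
exists (r ^+ 4); split => //.
move=> w w0; have Qw := Qpos w0.
have s0 : 0 < Num.sqrt (Q w) by rewrite sqrtr_gt0.
have := ubA w w0; rewrite normLqp2E => rle.
have N0 : (0 <= normLqp P p X Y ws 4 w)%E by exact: Lnorm_ge0.
have r0 : 0 <= r by rewrite -lee_fin; exact: le_trans (ratio_ge0 N0 s0) rle.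
have four0 : 0 < 4 :> R by [].
have := ratio_poweR_le four0 N0 s0 rle; rewrite normLqp4E.
rewrite powR_mulrn; last by rewrite mulr_ge0 // ltW.
by rewrite exprMn (_ : 4 = 2 * 2)%N // [Num.sqrt _ ^+ _]exprM sqr_sqrtr // ltW.
Qed.

Lemma cp_ge w : w != 0 -> (0 <= cp P p X Y ws)%E /\
  (forall c, cp P p X Y ws = c%:E ->
     mean_powR P p X w <= (c * Num.sqrt (Q w)) `^ p).
Proof.
move=> w0; have Qw := Qpos w0.
have s0 : 0 < Num.sqrt (Q w) by rewrite sqrtr_gt0.
have N0 : (0 <= normLp P p X w)%E by exact: Lnorm_ge0.
have : (normLp P p X w / normLqp P p X Y ws 2 w <= cp P p X Y ws)%E.
  by apply: ereal_sup_ubound; exists w.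
rewrite normLqp2E => cle; split; first exact: le_trans (ratio_ge0 N0 s0) cle.
move=> c cE; rewrite cE in cle.
have p0 : 0 < p by exact: lt_trans p2.
by have := ratio_poweR_le p0 N0 s0 cle; rewrite normLpE lee_fin.
Qed.

End Ratios.

Lemma gt0_mulye_mul (R : realType) (a b : R) : 0 < a -> 0 < b ->
  (a%:E * +oo * b%:E = +oo)%E.
Proof. by move=> a0 b0; rewrite gt0_muley ?lte_fin // gt0_mulye ?lte_fin. Qed.

(** * The excess risk bound *)

Lemma probability_setI_ge (R : realType) (disp : measure_display)
    (T : measurableType disp) (P : probability T R) (A B : set T) (a b : R) :
  measurable A -> measurable B ->
  ((1 - a)%:E <= P A)%E -> ((1 - b)%:E <= P B)%E ->
  ((1 - (a + b))%:E <= P (A `&` B))%E.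
Proof.
move=> mA mB PA PB.
have compl C c : measurable C -> ((1 - c)%:E <= P C)%E -> (P (~` C) <= c%:E)%E.
  move=> mC PC; rewrite probability_setC // leeBlDr ?fin_num_measure //.
  have -> : 1%E = (c%:E + (1 - c)%:E)%E :> \bar R by rewrite -EFinD addrC subrK.
  by rewrite leeD2l.
rewrite -[A `&` B]setCK probability_setC; last by apply: measurableC; exact: measurableI.
rewrite EFinB; apply: leeB => //; rewrite setCI EFinD.
apply: (le_trans (measureU2 _ _ _)); [exact: measurableC | exact: measurableC |].
by apply: leeD; exact: compl.
Qed.

Theorem theorem4 (R : realType) (disp : measure_display)
  (T : measurableType disp) (P : probability T R) (d n : nat) (p delta : R)
  (X : {RV P >-> d.-tuple R}) (Y : {RV P >-> R})
  (Xs : 'I_n -> {RV P >-> d.-tuple R}) (Ys : 'I_n -> {RV P >-> R})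
  (ws : 'cV[R]_d) (what : T -> 'cV[R]_d)
  (hp : 2 < p) (hdelta : 0 < delta <= 1)
  (hsupport : forall w : 'cV[R]_d,
     P [set t | inner w (X t) = 0] = 1%E -> w = 0)
  (hid : forall i : 'I_n,
     identically_distributed P (fun t => (Xs i t, Ys i t))
       (fun t => (X t, Y t)))
  (hindep : mutually_independent P (fun i t => (Xs i t, Ys i t)))
  (hnoexact : ~ exists w : 'cV[R]_d, P [set t | Y t = inner w (X t)] = 1%E)
  (hY : ('E_P[fun t => (`|Y t| `^ p)%R] < +oo)%E)
  (hX : forall j : 'I_d, ('E_P[fun t => (`|tnth (X t) j| `^ p)%R] < +oo)%E)
  (hXY : forall j : 'I_d,
     ('E_P[fun t => (`|inner ws (X t) - Y t| `^ (2 * (p - 2))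
                      * tnth (X t) j ^+ 4)%R] < +oo)%E)
  (hws : forall w : 'cV[R]_d, (risk P p X Y ws <= risk P p X Y w)%E)
  (hH : Hp P p X Y ws \in unitmx)
  (hwhat : forall (t : T) (w : 'cV[R]_d),
     emp_risk p (fun i => Xs i t) (fun i => Ys i t) (what t) <=
     emp_risk p (fun i => Xs i t) (fun i => Ys i t) w)
  (hn : (196%:E * sigma2 P p X Y ws * (d%:R + 2 * ln (4 / delta))%:E
         <= n%:R%:E)%E) :
  with_probability_ge P (1 - delta)
    [set t |
      (risk P p X Y (what t) - risk P p X Y ws <=
       (2048 * p ^+ 2)%:E * grad_noise P p X Y ws / (n%:R * delta)%:E
       + ((512 * p ^+ 4)%:E * cp P p X Y ws ^+ 2 * grad_noise P p X Y ws
          / (n%:R * delta)%:E) `^ (p / 2)%R)%E].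
Proof.
have [a aE] : {a : R | a = 2048 * p ^+ 2} by exists (2048 * p ^+ 2).
have [b bE] : {b : R | b = 512 * p ^+ 4} by exists (512 * p ^+ 4).
rewrite -aE -bE.
have /andP[delta0 delta1] := hdelta.
have mX : measurable_fun setT (X : T -> d.-tuple R) by exact: measurable_funP.
have mY : measurable_fun setT (Y : T -> R) by exact: measurable_funP.
have mXs i : measurable_fun setT (Xs i : T -> d.-tuple R) by exact: measurable_funP.
have mYs i : measurable_fun setT (Ys i : T -> R) by exact: measurable_funP.
have momentY : (mean P (fun t => `|Y t| `^ p)%R < +oo)%E by move: hY; rewrite unlock.
have momentX j : (mean P (fun t => `|tnth (X t) j| `^ p)%R < +oo)%E.
  by move: (hX j); rewrite unlock.
pose Q w := mean_curvature P p X Y ws w.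
have QE w : Q w = qform (Hp P p X Y ws) w by exact: mean_curvatureE.
have Hsym : (Hp P p X Y ws)^T = Hp P p X Y ws by exact: Hp_sym.
have Q0 w : 0 <= Q w by exact: mean_curvature_ge0.
have Qpos w : w != 0 -> 0 < Q w.
  by move=> w0; rewrite QE; apply: qform_unit_gt0 => // v; rewrite -QE.
have [B Bu BHB] := qform_orthonormal Hsym (fun w w0 => eq_ind _ (fun x => 0 < x) (Qpos w w0) _ (QE w)).
have d41 : 1 < 4 / delta by rewrite ltr_pdivlMr // mul1r; lra.
have L0 : 0 < d%:R + 2 * ln (4 / delta).
  by rewrite ltr_wpDl // mulr_gt0 // ln_gt0.
have [kappa [d0 nlarge fourthQ]] := sigma2_finite hp mX mY momentY momentX Qpos L0 hn.
pose V0 t : d.-tuple R * R := (X t, Y t).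
pose V i t : d.-tuple R * R := (Xs i t, Ys i t).
have mV0 : measurable_fun setT V0 by exact: measurable_fun_pair.
have mV i : measurable_fun setT (V i) by exact: measurable_fun_pair.
pose z := white p ws B.
have mz j : measurable_fun setT (z j) by exact: measurable_white.
have second u : mean P (fun t => lin z u (V0 t) ^+ 2) = (normsq u)%:E.
  exact: white_second.
have lin_curv u t : lin z u (V0 t) ^+ 4 = curvature_term p X Y ws (B *m \col_k u k) t ^+ 2.
  rewrite (_ : 4 = 2 * 2)%N // exprM; congr (_ ^+ 2).
  by rewrite /z lin_white exprMn sqr_sqrtr // powR_ge0.
have fourth u : (mean P (fun t => lin z u (V0 t) ^+ 4)%R <= (kappa * normsq u ^+ 2)%:E)%E.
  rewrite (eq_mean P (lin_curv u)).
  have -> : normsq u = Q (B *m \col_k u k).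
    by rewrite QE (qform_mulmx BHB); apply: eq_bigr => k _; rewrite mxE.
  have [->|u0] := eqVneq (B *m \col_k u k) 0; last exact: fourthQ.
  have curv0 t : curvature_term p X Y ws 0 t ^+ 2 = 0.
    by rewrite /curvature_term -(scale0r (0 : 'cV[R]_d)) innerZ mul0r expr0n mulr0 expr0n.
  rewrite (eq_mean P curv0) mean_cst lee_fin.
  by rewrite /Q -(scale0r (0 : 'cV[R]_d)) mean_curvatureZ // expr0n mul0r expr0n mulr0.
(* a fourth moment dominates the square of the second one *)
have kappa1 : 1 <= kappa.
  pose u : 'I_d -> R := fun i => (i == Ordinal d0)%:R.
  have u1 : normsq u = 1 by exact: normsq_delta.
  have ml : measurable_fun setT (fun t => lin z u (V0 t)).
    by apply: (measurableT_comp (f := lin z u)) => //; exact: measurable_lin.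
  have l40 t : 0 <= lin z u (V0 t) ^+ 4 by rewrite (_ : 4 = 2 * 2)%N // exprM sqr_ge0.
  have : (mean P (fun t => 2 * lin z u (V0 t) ^+ 2)%R <=
          mean P (fun t => 1 + lin z u (V0 t) ^+ 4)%R)%E.
    apply: mean_le.
    - by apply: measurable_funM => //; exact: measurable_funX.
    - by apply: measurable_funD => //; exact: measurable_funX.
    - by move=> t; rewrite mulr_ge0 ?sqr_ge0.
    - move=> t; rewrite (_ : 4 = 2 * 2)%N // exprM; set y := _ ^+ 2.
      by have := sqr_ge0 (y - 1); rewrite sqrrB1 expr2; lra.
  rewrite (meanZ P (measurable_funX 2 ml) (fun t => sqr_ge0 _)) // second u1.
  rewrite meanD // ?mean_cst; last exact: measurable_funX.
  move=> h; have {h} := le_trans h (leeD2l _ (fourth u)).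
  by rewrite u1 expr1n mulr1 -EFinM -EFinD lee_fin; lra.
have n0 : (0 < n)%N.
  rewrite -(ltr0n R); apply: lt_le_trans nlarge.
  by rewrite !mulr_gt0 // (lt_le_trans _ kappa1).
have nR : 0 < n%:R :> R by rewrite ltr0n.
have [A1 [mA1 PA1 low]] := lower_tail mV0 mV hid hindep mz d0
  (lt_le_trans ltr01 kappa1) second fourth hdelta nlarge.
have nd : 0 < n%:R * delta by rewrite mulr_gt0.
have p0 : 0 < p by exact: lt_trans hp.
have noiseE : grad_noise P p X Y ws = mean P (fun t => \sum_k score p ws B k (V0 t) ^+ 2).
  exact: grad_noiseE.
have noise0 : (0 <= grad_noise P p X Y ws)%E.
  by rewrite noiseE mean_ge0 // => t; apply: sumr_ge0 => k _; exact: sqr_ge0.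
have nd_inv : ((n%:R * delta)%:E^-1 = ((n%:R * delta)^-1)%:E :> \bar R)%E.
  by rewrite inver gt_eqF.
have a0 : 0 < a by rewrite aE; apply: mulr_gt0; [lra | exact: exprn_gt0].
have b0 : 0 < b by rewrite bE; apply: mulr_gt0; [lra | exact: exprn_gt0].
have ndi0 : 0 < (n%:R * delta)^-1 by rewrite invr_gt0.
have [noise_oo|noise_fin] := eqVneq (grad_noise P p X Y ws) +oo%E.
  exists setT; split => //; last first.
    by rewrite probability_setT lee_fin; lra.
  move=> t _ /=; apply: (@le_trans _ _ +oo%E); first exact: leey.
  rewrite noise_oo nd_inv (gt0_mulye_mul a0 ndi0) addye //.
  by rewrite gt_eqF // (lt_le_trans _ (poweR_ge0 _ _)).
have [G GE] : exists G, grad_noise P p X Y ws = G%:E.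
  by move: noise0 noise_fin; case: (grad_noise _ _ _ _ _) => [G||] //; exists G.
have [A2 [mA2 PA2 noise]] := score_noise hp mX mY mXs mYs momentY momentX hid hindep
  hws BHB n0 delta0 GE.
exists (A1 `&` A2); split.
- exact: measurableI.
- move=> t [A1t A2t] /=.
  set u := what t - ws.
  have wE : what t = ws + u by rewrite /u addrC subrK.
  have slope0 : mean_slope P p X Y ws u = 0.
    exact: (minimizer_mean_slope0 hp mX mY momentY momentX).
  have := risk_bregman_le hp mX mY momentY momentX ws u.
  rewrite slope0 subr0 -wE => excess.
  rewrite (riskE hp mX mY momentY momentX (what t)) (riskE hp mX mY momentY momentX ws).
  rewrite -EFinB GE nd_inv.
  have G0 : 0 <= G by rewrite -lee_fin -GE.
  have p1 : 0 < p - 1 by lra.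
  have Qu : Q u <= 512 * p ^+ 2 * G / (n%:R * delta).
    have := @empirical_minimizer_le _ _ _ _ _ _ _ X Y (fun i => Xs i) (fun i => Ys i)
      ws hp B BHB t (what t) n0 (low t A1t) (hwhat t ws).
    rewrite -/u -QE => Qn.
    have S0 : 0 <= (16 * (p - 1)) ^+ 2 by exact: sqr_ge0.
    have {}Qn := le_trans Qn (ler_wpM2l S0 (noise t A2t)).
    have n2 : 0 < n%:R ^+ 2 :> R by rewrite exprn_gt0.
    rewrite -(ler_pM2r n2); apply: (le_trans Qn).
    have -> : 512 * p ^+ 2 * G / (n%:R * delta) * n%:R ^+ 2 =
        p ^+ 2 * (512 * n%:R * G / delta) by field; rewrite !gt_eqF.
    have -> : (16 * (p - 1)) ^+ 2 * (2 * n%:R * G / delta) =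
        (p - 1) ^+ 2 * (512 * n%:R * G / delta) by field; rewrite gt_eqF.
    apply: ler_wpM2r; last by rewrite !expr2; nra.
    apply: divr_ge0; last exact: ltW.
    by apply: mulr_ge0 G0; apply: mulr_ge0; [lra | exact: ltW].
  have [u0|u0] := eqVneq u 0.
    have -> : what t = ws by rewrite wE u0 addr0.
    rewrite subrr; apply: adde_ge0; last exact: poweR_ge0.
    rewrite -!EFinM lee_fin; apply: mulr_ge0; last by rewrite invr_ge0 ltW.
    by apply: mulr_ge0 G0; exact: ltW.
  have Gpos : 0 < G.
    have c0 : 0 < 512 * p ^+ 2 by apply: mulr_gt0; [lra | exact: exprn_gt0].
    have := lt_le_trans (Qpos _ u0) Qu; rewrite pmulr_lgt0 ?invr_gt0 //.
    by rewrite (pmulr_rgt0 _ c0).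
  have [cp0 cpE] := cp_ge hp mX mY momentY momentX Qpos u0.
  case cE : (cp P p X Y ws) cp0 cpE => [c||] // cp0 cpE; last first.
    have Gnd0 : 0 < G * (n%:R * delta)^-1 by rewrite mulr_gt0.
    have -> : (b%:E * +oo ^+ 2 * G%:E * ((n%:R * delta)^-1)%:E = +oo)%E.
      by rewrite -muleA -EFinM; exact: (gt0_mulye_mul b0 Gnd0).
    rewrite poweRyr; last by rewrite gt_eqF // divr_gt0.
    by rewrite -!EFinM addey ?leey.
  have {}cpE := cpE c erefl; rewrite lee_fin in cp0.
  rewrite -!EFinM poweR_EFin -EFinD lee_fin -expr2.
  apply: (le_trans excess); apply: lerD.
    have -> : a * G / (n%:R * delta) = 4 * (512 * p ^+ 2 * G / (n%:R * delta)).
      by rewrite aE; ring.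
    by apply: ler_wpM2l => //; lra.
  have s0 : 0 <= c * Num.sqrt (Q u) by rewrite mulr_ge0 // sqrtr_ge0.
  have ps0 : 0 <= p * (c * Num.sqrt (Q u)) by rewrite mulr_ge0 // ltW.
  apply: (@le_trans _ _ ((p * (c * Num.sqrt (Q u))) `^ p)).
    by rewrite (powRM p (ltW p0) s0); exact: (ler_wpM2l (powR_ge0 _ _) cpE).
  have -> : (p * (c * Num.sqrt (Q u))) `^ p =
      ((p * (c * Num.sqrt (Q u))) ^+ 2) `^ (p / 2).
    by rewrite norm_powR_sqr (ger0_norm ps0); congr powR; field.
  apply: ge0_ler_powR; rewrite ?nnegrE ?sqr_ge0 //.
  - by rewrite divr_ge0 // ltW.
  - apply: mulr_ge0; last by rewrite invr_ge0 ltW.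
    by apply: mulr_ge0 G0; apply: mulr_ge0; [exact: ltW | exact: sqr_ge0].
  rewrite !exprMn sqr_sqrtr // mulrA.
  have -> : b * c ^+ 2 * G / (n%:R * delta) =
     p ^+ 2 * c ^+ 2 * (512 * p ^+ 2 * G / (n%:R * delta)) by rewrite bE; ring.
  by rewrite ler_wpM2l // mulr_ge0 ?sqr_ge0.
- have -> : delta = delta / 2 + delta / 2 by field.
  exact: probability_setI_ge.
Qed.
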